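(* Let $j\in\{0,1\}$ and let $k,i$ be integers with $k\geq i\geq 2$ and $(2k+j)/2>2$. Then for $|q|<1$ ($q\neq 0$), $$\sum_{N_1\geq \cdots\geq N_{k-1}\geq0}\frac{q^{2(N_1^2+\cdots+N_{k-1}^2+N_i+\cdots+N_{k-1})}(-q^{1-2N_2};q^2)_{N_2}(-q^{1+2N_1};q^2)_\infty}{(q^2;q^2)_{N_1-N_2}\cdots(q^2;q^2)_{N_{k-2}-N_{k-1}} (q^{4-2j};q^{4-2j})_{N_{k-1}}}=\frac{(q^2;q^4)_\infty(q^{4k-2+2j},q^{2i-1},q^{4k-2i-1+2j};q^{4k-2+2j})_\infty}{(q;q)_\infty}.$$
   Context: Notation: $(a;q)_\infty=\prod_{m=0}^\infty(1-aq^m)$, $(a;q)_n=(a;q)_\infty/(aq^n;q)_\infty$ (so $(a;q)_n=\prod_{m=0}^{n-1}(1-aq^m)$ for $n\ge 0$), and $(a_1,\ldots,a_m;q)_\infty=(a_1;q)_\infty\cdots(a_m;q)_\infty$. The sum runs over integers $N_1\ge\cdots\ge N_{k-1}\ge 0$. When $i=k$ the sum $N_i+\cdots+N_{k-1}$ is empty (equal to $0$). When $k=2$ (which forces $j=1$, $i=2$) one takes $N_2=0$, so that $(-q^{1-2N_2};q^2)_{N_2}=1$ and the denominator is $(q^{4-2j};q^{4-2j})_{N_1}=(q^2;q^2)_{N_1}$. *)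

(* Defs.v *)
(* MathComp-Analysis. The base field is an arbitrary numFieldType, with the
   topology of its norm; it is meant for R[i] with R : realType. *)
From HB Require Import structures.
From mathcomp Require Import all_boot all_order all_algebra.
From mathcomp Require Import finmap.
From mathcomp Require Import all_classical all_reals all_analysis.
From mathcomp Require Import complex.
From mathcomp Require Import showcase.summability.

Set Implicit Arguments.
Unset Strict Implicit.
Unset Printing Implicit Defensive.

Import Order.TTheory GRing.Theory Num.Theory.
Import numFieldNormedType.Exports.

Local Open Scope classical_set_scope.
Local Open Scope ring_scope.

(* Only n >= 0 is needed, where (a;q)_oo / (aq^n;q)_oo is a finite product. *)
Definition qpoch (C : numFieldType) (a q : C) (n : nat) : C :=
  \prod_(m < n) (1 - a * q ^+ m).

(* [lim] is a default value when there is no limit; the limit exists when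
   `|q| < 1 and C is complete, so in particular for C := R[i]. *)
Definition qpoch_inf (C : numFieldType) (a q : C) : C :=
  lim (qpoch a q n @[n --> \oo]).

(* Chains N_1 >= ... >= N_r >= 0 of length r. *)
Definition chain (r : nat) := {N : r.-tuple nat | sorted geq N}.

(* Indices start at 1; N_m = 0 past the end, so that N_2 = 0 when r = 1. *)
Definition part (r : nat) (N : chain r) (m : nat) : nat :=
  nth 0%N (val N) m.-1.

(* The exponent 1 - 2 N_2 is negative in general, hence the integer power. The
   differences N_m - N_(m+1) are taken for 1 <= m <= k - 2 only and are never
   truncated, as N is nonincreasing. *)
Definition multisum_term (C : numFieldType) (q : C) (j k i : nat)
    (N : chain k.-1) : C :=
  q ^+ (2 * (\sum_(1 <= m < k) part N m ^ 2 + \sum_(i <= m < k) part N m))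
  * qpoch (- q ^ (1%:Z - (2 * part N 2)%:Z)) (q ^+ 2) (part N 2)
  * qpoch_inf (- q ^+ (1 + 2 * part N 1)) (q ^+ 2)
  / (\prod_(1 <= m < k.-1) qpoch (q ^+ 2) (q ^+ 2) (part N m - part N m.+1)
     * qpoch (q ^+ (4 - 2 * j)) (q ^+ (4 - 2 * j)) (part N k.-1)).

Arguments multisum_term {C} q j k i N.

Definition product_side (C : numFieldType) (q : C) (j k i : nat) : C :=
  let b := q ^+ (4 * k - 2 + 2 * j) in
  qpoch_inf (q ^+ 2) (q ^+ 4)
  * (qpoch_inf b b
     * qpoch_inf (q ^+ (2 * i - 1)) b
     * qpoch_inf (q ^+ (4 * k - 2 * i - 1 + 2 * j)) b)
  / qpoch_inf q q.

(* Main.v *)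
(* With p = q^2, put rf(n) = 1/(p;p)_n (zero for n < 0) and
     beta_{A,B}(n) = sum_{s in Z} (-1)^s q^(A s^2 + B s) rf(n - s) rf(n + s).
   By the q-Chu-Vandermonde sum, summing over N_m against q^(2 N_m^2) rf(n - N_m)
   raises A by 2, and doing so against the weight of N_2 raises A by 1. The
   linear terms 2 N_m are handled by the companion sums with rf(n + s + 1) instead
   of rf(n + s), for which A and B both go up by 2. The two kinds of sums agree
   when B = A - 2, by antisymmetry under s |-> -1 - s, which is how one passes
   from the indices m >= i to the indices m < i. Hence the multisum restricted to
   N_1 <= n and weighted by rf(n - N_1) is beta_{A,B}(n) with A = 2k - 1 + j and
   B = 2k + j - 2i, up to the factor (-q;q^2)_oo. Letting n tend to infinity turns
   this identity into the theorem, by dominated convergence and the Jacobi triple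
   product, itself the limit of a finite form. *)
Require Import Defs.
From HB Require Import structures.
From mathcomp Require Import all_boot all_order all_algebra.
From mathcomp Require Import finmap.
From mathcomp Require Import all_classical all_reals all_analysis.
From mathcomp Require Import complex.
From mathcomp Require Import showcase.summability.
From mathcomp Require Import ring zify.
Import Order.TTheory GRing.Theory Num.Theory.
Import numFieldNormedType.Exports.
Local Open Scope classical_set_scope.
Local Open Scope ring_scope.
Set Implicit Arguments.
Unset Strict Implicit.
Unset Printing Implicit Defensive.

(** * Kernels from the q-Chu-Vandermonde sum *)

Section QSeries.
Context {C : numFieldType}.
Implicit Types (a p q x y : C) (s : int) (f : int -> C).

(** The two products in the numerators are disguised. Reversing the order of factors gives q^(N^2)
    (-q^(1-2N); q^2)_N = (-q; q^2)_N, so the weight of N_2 is q^(N_2^2) (-q; q^2)_(N_2), with half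
    the usual quadratic exponent. And (-q^(1+2 N_1); q^2)_oo is (-q; q^2)_oo / (-q; q^2)_(N_1),
    whose denominator cancels the factor (-q; q^2)_n left behind by the step at N_2. The chain
    starts below N_(k-1) with A = 2 + j and B = j: for j = 0 this is 1/(q^4; q^4)_n, and for j = 1
    it is one step above the unit pair A = B = 1, whose value is 1 at n = 0 and 0 elsewhere. The
    relation B = A - 2 holds at the start and survives every step with a linear term at N_m, m >= 3;
    this is what allows the switch between the two kinds of sums wherever it is needed. In the limit
    the finite identity carries 1/(q^2; q^2)_oo on the left and its square on the right. *)

Lemma qpochSr a q n : qpoch a q n.+1 = qpoch a q n * (1 - a * q ^+ n).
Proof. by rewrite /qpoch big_ord_recr. Qed.

Lemma qpoch0 a q : qpoch a q 0 = 1.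
Proof. by rewrite /qpoch big_ord0. Qed.

Lemma qpochD a q m n : qpoch a q (m + n) = qpoch a q m * qpoch (a * q ^+ m) q n.
Proof.
elim: n => [|n IHn]; first by rewrite addn0 qpoch0 mulr1.
by rewrite addnS !qpochSr IHn exprD !mulrA.
Qed.

Lemma qpochS a q n : qpoch a q n.+1 = (1 - a) * qpoch (a * q) q n.
Proof. by rewrite -add1n qpochD qpochSr qpoch0 expr0 mulr1 mul1r expr1. Qed.

Lemma qpoch0x q n : qpoch 0 q n = 1.
Proof. by rewrite /qpoch big1 // => i _; rewrite mul0r subr0. Qed.

Lemma qpoch_neq0 a q n : (forall l, a * q ^+ l != 1) -> qpoch a q n != 0.
Proof.
move=> h; apply/prodf_neq0 => i _.
by rewrite subr_eq0 eq_sym.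
Qed.

Definition not_root_of_unity q := forall n, (0 < n)%N -> q ^+ n != 1.

Lemma not_root_of_unityX q n :
  not_root_of_unity q -> (0 < n)%N -> not_root_of_unity (q ^+ n).
Proof. by move=> h n0 m m0; rewrite -exprM h // muln_gt0 n0. Qed.

Lemma not_root_of_unity_mul p n l :
  not_root_of_unity p -> (0 < n)%N -> p ^+ n * p ^+ l != 1.
Proof. by move=> h n0; rewrite -exprD h // addn_gt0 n0. Qed.

Lemma qpochpp_neq0 p n : not_root_of_unity p -> qpoch p p n != 0.
Proof. by move=> h; apply: qpoch_neq0 => l; apply: (@not_root_of_unity_mul p 1). Qed.

(* The convention 1/(p;p)_z = 0 for z < 0 makes all the sums over s in Z below
   finitely supported. *)
Definition qpochV p (z : int) : C := if z is Posz n then (qpoch p p n)^-1 else 0.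
Arguments qpochV : simpl never.

Lemma qpochV_neg p z : (z < 0)%R -> qpochV p z = 0.
Proof. by case: z. Qed.

Lemma qpochV0 p : qpochV p 0 = 1.
Proof. by rewrite /qpochV /= qpoch0 invr1. Qed.

Lemma qpochV_pred p z : not_root_of_unity p ->
  qpochV p (z - 1) = (1 - p ^ z) * qpochV p z.
Proof.
move=> hp; case: z => [[|n]|n]; last by rewrite (_ : Negz n - 1 = Negz n.+1) ?mulr0 //; lia.
  by rewrite expr0z subrr mul0r.
rewrite (_ : n.+1%:Z - 1 = n%:Z); last by lia.
rewrite /qpochV qpochSr -exprS -exprnP invfM mulrCA mulfV ?mulr1 //.
by rewrite subr_eq0 eq_sym hp.
Qed.

(** For y != 0 this is (-y)^u p^(u(u-1)/2) (x/y; p)_u. *)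
Let term p x y u := \prod_(l < u) (x * p ^+ (2 * l) - y * p ^+ l).

Let cvsum p x y m := \sum_(u < m.+1)
  qpochV p (m%:Z - u%:Z) * qpochV p u%:Z * (term p x y u / qpoch x p u).

Let termS p x y u : term p x y u.+1 = (x - y) * (p ^+ u * term p (x * p) y u).
Proof.
rewrite /term big_ord_recl muln0 !expr0 !mulr1; congr (_ * _).
have -> : p ^+ u = \prod_(l < u) p by rewrite prodr_const card_ord.
rewrite -big_split /=; apply: eq_bigr => i _.
by rewrite /bump /= add1n mulnS exprD expr2 exprS; ring.
Qed.

(** Splits 1 - p^(m+1) as (1 - p^(m+1-u)) + p^(m+1-u) (1 - p^u). Each bracket lowers one of the two
    [qpochV]; in the second sum, shifting u replaces x by x p. *)
Let cvsum_rec p x y m : not_root_of_unity p -> x != 1 ->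
  (1 - p ^+ m.+1) * cvsum p x y m.+1
  = cvsum p x y m + p ^+ m * ((x - y) / (1 - x)) * cvsum p (x * p) y m.
Proof.
move=> hp x1.
have -> : cvsum p x y m = \sum_(u < m.+2)
    qpochV p (m%:Z - u%:Z) * qpochV p u%:Z * (term p x y u / qpoch x p u).
  by rewrite /cvsum [RHS]big_ord_recr /= qpochV_neg ?mul0r ?addr0 //; lia.
have -> : p ^+ m * ((x - y) / (1 - x)) * cvsum p (x * p) y m = \sum_(u < m.+2)
    p ^ (m.+1%:Z - u%:Z) * qpochV p (m.+1%:Z - u%:Z) * qpochV p (u%:Z - 1)
    * (term p x y u / qpoch x p u).
  rewrite [RHS]big_ord_recl /= mulr0 mul0r add0r /cvsum big_distrr /=.
  apply: eq_bigr => u _.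
  rewrite /bump /= add1n termS qpochS.
  rewrite (_ : m.+1%:Z - u.+1%:Z = (m - u)%N%:Z); last by have := ltn_ord u; lia.
  rewrite (_ : u.+1%:Z - 1 = u%:Z); last by lia.
  rewrite (_ : m%:Z - u%:Z = (m - u)%N%:Z); last by have := ltn_ord u; lia.
  rewrite -exprnP invfM -{1}(subnK (_ : u <= m)%N) ?exprD; last by rewrite -ltnS.
  by ring.
rewrite -big_split /cvsum big_distrr /=; apply: eq_bigr => u _.
rewrite (_ : m%:Z - u%:Z = m.+1%:Z - u%:Z - 1); last by lia.
rewrite !qpochV_pred //.
have -> : p ^+ m.+1 = p ^ (m.+1%:Z - u%:Z) * p ^ u%:Z.
  rewrite (_ : m.+1%:Z - u%:Z = (m.+1 - u)%N%:Z); last by have := ltn_ord u; lia.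
  by rewrite -!exprnP -exprD subnK // -ltnS.
by ring.
Qed.

(* The q-Chu-Vandermonde sum 2phi1(p^-m, rho; x; p, x p^m / rho) with
   rho = x / y, in a form that makes sense for x = 0 or y = 0. *)
Lemma q_chu_vandermonde p x y m : not_root_of_unity p ->
  (forall l, x * p ^+ l != 1) ->
  \sum_(u < m.+1) qpochV p (m%:Z - u%:Z) * qpochV p u%:Z *
     (\prod_(l < u) (x * p ^+ (2 * l) - y * p ^+ l) / qpoch x p u)
  = qpoch y p m / (qpoch p p m * qpoch x p m).
Proof.
move=> hp; rewrite -/(cvsum p x y m); elim: m x => [|m IHm] x hx.
  by rewrite /cvsum big_ord1 /term big_ord0 !qpochV0 !qpoch0; field.
have hx' l : x * p * p ^+ l != 1 by rewrite -mulrA -exprS.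
have x1 : x != 1 by have := hx 0%N; rewrite expr0 mulr1.
have hpm : 1 - p ^+ m.+1 != 0 by rewrite subr_eq0 eq_sym hp.
apply: (mulfI hpm); rewrite cvsum_rec // (IHm _ hx) (IHm _ hx').
have [h1 h2] := (qpochpp_neq0 m hp, qpoch_neq0 m hx).
have h4 : 1 - x != 0 by rewrite subr_eq0 eq_sym.
have h5 : 1 - x * p ^+ m != 0 by rewrite subr_eq0 eq_sym.
have e : qpoch (x * p) p m = qpoch x p m * (1 - x * p ^+ m) / (1 - x).
  by rewrite -qpochSr qpochS mulrAC mulfV ?mul1r.
rewrite e !qpochSr -exprS.
by field; rewrite h1 h2 h4 h5 hpm.
Qed.

(** Terms with r < s vanish, and r = s + u turns the sum into q-Chu-Vandermonde with x = p^(2s+e+1);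
    the hypothesis on [W] asks for exactly its term ratio. The values e = 0 and e = 1 give the two
    kernels, y = 0 the plain weights and y != 0 those containing (-q; q^2)_r. *)
Lemma nonneg_kernel p (W : nat -> C) y (s e n : nat) : not_root_of_unity p ->
  (forall u, W (s + u).+1
     = W (s + u)%N * (p ^+ (2 * s + e).+1 * p ^+ (2 * u) - y * p ^+ u)) ->
  \sum_(r < n.+1) qpochV p (n%:Z - r%:Z) * W r
     * (qpochV p (r%:Z - s%:Z) * qpochV p (r%:Z + s%:Z + e%:Z))
  = W s * qpoch y p (n - s)
    * (qpochV p (n%:Z - s%:Z) * qpochV p (n%:Z + s%:Z + e%:Z)).
Proof.
move=> hp hW; have [sn|ns] := leqP s n; last first.
  rewrite [in RHS](@qpochV_neg p (n%:Z - s%:Z)); last by lia.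
  rewrite mul0r mulr0 big1 // => r _.
  rewrite [X in _ * (X * _)]qpochV_neg ?mul0r ?mulr0 //.
  by have := ltn_ord r; lia.
have [m {n sn}->] : exists m, n = (s + m)%N by exists (n - s)%N; lia.
rewrite addKn.
have hx l : p ^+ (2 * s + e).+1 * p ^+ l != 1 by apply: not_root_of_unity_mul.
have hWu u : W (s + u)%N
    = W s * \prod_(l < u) (p ^+ (2 * s + e).+1 * p ^+ (2 * l) - y * p ^+ l).
  elim: u => [|u IHu]; first by rewrite addn0 big_ord0 mulr1.
  by rewrite addnS hW big_ord_recr IHu /= mulrA.
have hV u : qpochV p ((s + u)%N%:Z + s%:Z + e%:Z)
    = qpochV p (2 * s + e)%N%:Z / qpoch (p ^+ (2 * s + e).+1) p u.
  rewrite -!PoszD (_ : (s + u + s + e = 2 * s + e + u)%N); last by lia.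
  by rewrite /qpochV qpochD invfM -exprS.
rewrite -addnS big_split_ord /= big1 ?add0r; last first.
  move=> r _; rewrite [X in _ * (X * _)]qpochV_neg ?mul0r ?mulr0 //.
  by have := ltn_ord r; lia.
transitivity (W s * qpochV p (2 * s + e)%N%:Z * (\sum_(u < m.+1)
    qpochV p (m%:Z - u%:Z) * qpochV p u%:Z *
    (\prod_(l < u) (p ^+ (2 * s + e).+1 * p ^+ (2 * l) - y * p ^+ l)
       / qpoch (p ^+ (2 * s + e).+1) p u))).
  rewrite big_distrr /=; apply: eq_bigr => u _.
  rewrite (_ : (s + m)%N%:Z - (s + u)%N%:Z = m%:Z - u%:Z); last by lia.
  rewrite (_ : (s + u)%N%:Z - s%:Z = u%:Z); last by lia.
  by rewrite hV hWu; ring.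
rewrite q_chu_vandermonde //.
rewrite (_ : (s + m)%N%:Z - s%:Z = m%:Z); last by lia.
rewrite hV invfM [in qpochV p m]/qpochV.
by ring.
Qed.

Let even_kernel p (W : nat -> C) (c : int -> C) v (n : nat) :
  (forall s, c (- s) = c s) ->
  (forall t : nat, \sum_(r < n.+1) qpochV p (n%:Z - r%:Z) * W r
     * (qpochV p (r%:Z - t%:Z) * qpochV p (r%:Z + t%:Z))
   = c t%:Z * v * (qpochV p (n%:Z - t%:Z) * qpochV p (n%:Z + t%:Z))) ->
  forall s, \sum_(r < n.+1) qpochV p (n%:Z - r%:Z) * W r
     * (qpochV p (r%:Z - s) * qpochV p (r%:Z + s))
   = c s * v * (qpochV p (n%:Z - s) * qpochV p (n%:Z + s)).
Proof.
move=> hc H [t|t]; first exact: H.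
rewrite NegzE hc opprK [X in _ = _ * X]mulrC -H.
by apply: eq_bigr => r _; rewrite [qpochV p _ * qpochV p (_ - _)]mulrC.
Qed.

Let odd_kernel p (W : nat -> C) (c : int -> C) v (n : nat) :
  (forall s, c (- 1 - s) = c s) ->
  (forall t : nat, \sum_(r < n.+1) qpochV p (n%:Z - r%:Z) * W r
     * (qpochV p (r%:Z - t%:Z) * qpochV p (r%:Z + t%:Z + 1))
   = c t%:Z * v * (qpochV p (n%:Z - t%:Z) * qpochV p (n%:Z + t%:Z + 1))) ->
  forall s, \sum_(r < n.+1) qpochV p (n%:Z - r%:Z) * W r
     * (qpochV p (r%:Z - s) * qpochV p (r%:Z + s + 1))
   = c s * v * (qpochV p (n%:Z - s) * qpochV p (n%:Z + s + 1)).
Proof.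
move=> hc H [t|t]; first exact: H.
have es (z : int) : z - Negz t = z + t%:Z + 1 by rewrite NegzE; lia.
have es' (z : int) : z + Negz t + 1 = z - t%:Z by rewrite NegzE; lia.
rewrite -hc (_ : -1 - Negz t = t%:Z); last by rewrite NegzE; lia.
rewrite es es' [X in _ = _ * X]mulrC -H.
by apply: eq_bigr => r _; rewrite es es' [qpochV p _ * qpochV p (_ - _)]mulrC.
Qed.

Lemma kernel_even p n s : not_root_of_unity p ->
  \sum_(r < n.+1) qpochV p (n%:Z - r%:Z) * p ^+ (r ^ 2)
     * (qpochV p (r%:Z - s) * qpochV p (r%:Z + s))
  = p ^ (s ^+ 2) * 1 * (qpochV p (n%:Z - s) * qpochV p (n%:Z + s)).
Proof.
move=> hp; apply: (@even_kernel p (fun r => p ^+ (r ^ 2)) (fun s => p ^ (s ^+ 2)) 1) => [t|t].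
  by rewrite sqrrN.
have := @nonneg_kernel p (fun r => p ^+ (r ^ 2)) 0 t 0 n hp.
under eq_bigr do rewrite addr0; rewrite addr0 qpoch0x => -> // u.
rewrite mul0r subr0 -!exprD; congr (_ ^+ _); lia.
Qed.

Lemma kernel_odd p n s : not_root_of_unity p ->
  \sum_(r < n.+1) qpochV p (n%:Z - r%:Z) * p ^+ (r ^ 2 + r)
     * (qpochV p (r%:Z - s) * qpochV p (r%:Z + s + 1))
  = p ^ (s ^+ 2 + s) * 1 * (qpochV p (n%:Z - s) * qpochV p (n%:Z + s + 1)).
Proof.
move=> hp; apply: (@odd_kernel p (fun r => p ^+ (r ^ 2 + r))
  (fun s => p ^ (s ^+ 2 + s)) 1) => [t|t].
  by congr (_ ^ _); ring.
have := @nonneg_kernel p (fun r => p ^+ (r ^ 2 + r)) 0 t 1 n hp.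
rewrite qpoch0x => -> // u.
rewrite mul0r subr0 -!exprD; congr (_ ^+ _); lia.
Qed.

(** Here y = -q^(2t+1), and (-q; q^2)_t (-q^(2t+1); q^2)_(n-t) = (-q; q^2)_n no longer involves t:
    only q^(s^2) stays attached to s. *)
Lemma half_kernel_even q n s : not_root_of_unity q ->
  \sum_(r < n.+1) qpochV (q ^+ 2) (n%:Z - r%:Z)
       * (q ^+ (r ^ 2) * qpoch (- q) (q ^+ 2) r)
     * (qpochV (q ^+ 2) (r%:Z - s) * qpochV (q ^+ 2) (r%:Z + s))
  = q ^ (s ^+ 2) * qpoch (- q) (q ^+ 2) n
     * (qpochV (q ^+ 2) (n%:Z - s) * qpochV (q ^+ 2) (n%:Z + s)).
Proof.
move=> hq; have hp := @not_root_of_unityX q 2 hq isT.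
apply: (@even_kernel _ (fun r => q ^+ (r ^ 2) * qpoch (- q) (q ^+ 2) r)
  (fun s => q ^ (s ^+ 2)) (qpoch (- q) (q ^+ 2) n)) => [t|t].
  by rewrite sqrrN.
have := @nonneg_kernel (q ^+ 2)
  (fun r => q ^+ (r ^ 2) * qpoch (- q) (q ^+ 2) r) (- q ^+ (2 * t).+1) t 0 n hp.
under eq_bigr do rewrite addr0; rewrite addr0 => ->; last first.
  move=> u; rewrite qpochSr -!exprM.
  rewrite mulNr -exprS !mulNr -!exprD !opprK.
  rewrite (_ : (t + u).+1 ^ 2 = (t + u) ^ 2 + ((2 * t).+1 + 2 * u))%N; last by lia.
  rewrite (_ : 2 * (2 * t + 0).+1 + 2 * (2 * u)
    = (2 * t).+1 + 2 * u + (2 * (t + u)).+1)%N; last by lia.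
  by rewrite !(exprD q (_ ^ 2)) (exprD q _ (2 * (t + u)).+1); ring.
have [tn|nt] := leqP t n; last first.
  by rewrite (@qpochV_neg _ (n%:Z - t%:Z)) ?mul0r ?mulr0 //; lia.
congr (_ * _); rewrite -[in RHS](subnKC tn) qpochD -exprM mulNr -exprS.
by rewrite -!exprnP; ring.
Qed.

Lemma not_root_of_unity_neq0 q : q != 0 -> not_root_of_unity q ->
  forall z : int, z != 0 -> q ^ z != 1.
Proof.
move=> q0 hq [[|n]|n] //= _; first exact: hq.
by rewrite NegzE -invr_expz invr_eq1 hq.
Qed.

Lemma onePoddX_neq0 q s : q != 0 -> not_root_of_unity q ->
  1 + q ^ (2 * s + 1) != 0.
Proof.
move=> q0 hq; rewrite addr_eq0 eq_sym eqr_oppLR.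
have : q ^ ((2 * s + 1) * 2) != 1 by apply: not_root_of_unity_neq0 => //; lia.
by apply: contra_neq; rewrite -exprz_exp => ->; rewrite -exprnP sqrrN expr1n.
Qed.

(** Now y = -q^(2t+3), so the two pieces of (-q; q^2)_(n+1) leave out the factor 1 + q^(2t+1). This
    is the origin of the denominator, which [bailey_half_odd] removes by antisymmetry. *)
Lemma half_kernel_odd q n s : q != 0 -> not_root_of_unity q ->
  \sum_(r < n.+1) qpochV (q ^+ 2) (n%:Z - r%:Z)
       * (q ^+ (r ^ 2 + 2 * r) * qpoch (- q) (q ^+ 2) r)
     * (qpochV (q ^+ 2) (r%:Z - s) * qpochV (q ^+ 2) (r%:Z + s + 1))
  = q ^ (s ^+ 2 + 2 * s) / (1 + q ^ (2 * s + 1)) * qpoch (- q) (q ^+ 2) n.+1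
     * (qpochV (q ^+ 2) (n%:Z - s) * qpochV (q ^+ 2) (n%:Z + s + 1)).
Proof.
move=> q0 hq; have hp := @not_root_of_unityX q 2 hq isT.
apply: (@odd_kernel _ (fun r => q ^+ (r ^ 2 + 2 * r) * qpoch (- q) (q ^+ 2) r)
  (fun s => q ^ (s ^+ 2 + 2 * s) / (1 + q ^ (2 * s + 1)))
  (qpoch (- q) (q ^+ 2) n.+1)) => [t|t].
  rewrite (_ : 2 * (-1 - t) + 1 = - (2 * t + 1)); last by lia.
  rewrite (_ : (-1 - t) ^+ 2 + 2 * (-1 - t) = t ^+ 2 + 2 * t - (2 * t + 1)); last by ring.
  have h1 := onePoddX_neq0 t q0 hq.
  have h2 : q ^ (2 * t + 1) != 0 by apply: expfz_neq0.
  rewrite expfzDr // -invr_expz.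
  by field; rewrite h1 h2.
have := @nonneg_kernel (q ^+ 2)
  (fun r => q ^+ (r ^ 2 + 2 * r) * qpoch (- q) (q ^+ 2) r) (- q ^+ (2 * t).+3) t 1 n hp.
move=> ->; last first.
  move=> u; rewrite qpochSr -!exprM.
  rewrite mulNr -exprS !mulNr -!exprD !opprK.
  rewrite (_ : (t + u).+1 ^ 2 + 2 * (t + u).+1
    = (t + u) ^ 2 + 2 * (t + u) + ((2 * t).+3 + 2 * u))%N; last by lia.
  rewrite (_ : 2 * (2 * t + 1).+1 + 2 * (2 * u)
    = (2 * t).+3 + 2 * u + (2 * (t + u)).+1)%N; last by lia.
  by rewrite (exprD q _ ((2 * t).+3 + _)) (exprD q _ (2 * (t + u)).+1); ring.
have [tn|nt] := leqP t n; last first.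
  by rewrite (@qpochV_neg _ (n%:Z - t%:Z)) ?mul0r ?mulr0 //; lia.
congr (_ * _); rewrite -[in RHS](subnKC tn) -addnS qpochD.
rewrite qpochS -exprM mulNr -exprS mulNr -exprD addn2.
have h1 := onePoddX_neq0 t q0 hq.
rewrite -[q ^ (2 * t%:Z + 1)]/(q ^+ (2 * t + 1)) addn1 in h1 *.
rewrite -[q ^ (t%:Z ^+ 2 + 2 * t%:Z)]/(q ^+ (t ^ 2 + 2 * t)).
by field.
Qed.
End QSeries.

(** * Bilateral sums *)

Section BilateralSums.
Context {C : numFieldType}.
Implicit Types (p q y z : C) (s A B : int) (f g : int -> C).

(* The sum over the window -M <= s < M, which is stable under s |-> -1 - s. *)
Definition zsum (M : nat) f : C := \sum_(t < M) (f t%:Z + f (- 1 - t%:Z)).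

Lemma eq_zsum M f g : f =1 g -> zsum M f = zsum M g.
Proof. by move=> fg; apply: eq_bigr => t _; rewrite !fg. Qed.

Lemma zsumD M f g : zsum M (fun s => f s + g s) = zsum M f + zsum M g.
Proof. by rewrite /zsum -big_split; apply: eq_bigr => t _ /=; ring. Qed.

Lemma zsumZ M f (c : C) : zsum M (fun s => c * f s) = c * zsum M f.
Proof. by rewrite /zsum big_distrr; apply: eq_bigr => t _ /=; ring. Qed.

Lemma zsumB M f g : zsum M (fun s => f s - g s) = zsum M f - zsum M g.
Proof.
by rewrite -mulN1r -zsumZ -zsumD; apply: eq_zsum => s; rewrite mulN1r.
Qed.

Lemma zsum_sum M n (F : 'I_n -> int -> C) :
  zsum M (fun s => \sum_(r < n) F r s) = \sum_(r < n) zsum M (F r).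
Proof. by rewrite [RHS]exchange_big; apply: eq_bigr => t _; rewrite -big_split. Qed.

Lemma zsum_anti M f : (forall s, f (- 1 - s) = - f s) -> zsum M f = 0.
Proof. by move=> h; rewrite /zsum big1 // => t _; rewrite h subrr. Qed.

Lemma zsum_widen M M' f : (M <= M')%N ->
  (forall t : nat, (M <= t)%N -> f t%:Z = 0 /\ f (- 1 - t%:Z) = 0) ->
  zsum M f = zsum M' f.
Proof.
move=> le h; rewrite /zsum -!(big_mkord xpredT (fun t : nat => f t%:Z + f (- 1 - t%:Z))).
rewrite [RHS](@big_cat_nat _ _ _ M) //= [X in _ = _ + X]big_nat_cond.
rewrite [X in _ + X]big1 ?addr0 // => t /andP[/andP[/h [-> ->] _] _].
by rewrite addr0.
Qed.

(** Shifting the window changes the sum by f(M) - f(-M); in the applications both values vanish by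
    finite support. *)
Lemma zsum_shift M f : f M%:Z = f (- M%:Z) -> zsum M (fun s => f (s + 1)) = zsum M f.
Proof.
move=> h.
suff -> : zsum M (fun s => f (s + 1)) = zsum M f + (f M%:Z - f (- M%:Z)).
  by rewrite h subrr addr0.
elim: M {h} => [|M IHM]; first by rewrite /zsum !big_ord0 subrr addr0.
rewrite /zsum !big_ord_recr /=; move: IHM; rewrite /zsum => ->.
rewrite (_ : -1 - M%:Z + 1 = - M%:Z); last by lia.
rewrite (_ : M%:Z + 1 = M.+1%:Z); last by lia.
rewrite (_ : -1 - M%:Z = - M.+1%:Z); last by lia.
by ring.
Qed.

Lemma signz_pred s : (- 1 : C) ^ (- 1 - s) = - (- 1) ^ s.
Proof.
rewrite expfzDr ?oppr_eq0 ?oner_eq0 // -invr_expz -[(-1) ^ (-1)]/((-1)^-1).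
rewrite invrN invr1 mulN1r; congr (- _).
have : (-1 : C) ^ s * (-1) ^ s = 1 by rewrite -expfzMl mulrNN mulr1 exp1rz.
move=> e; have n0 : (-1 : C) ^ s != 0 by rewrite expfz_neq0 ?oppr_eq0 ?oner_eq0.
by apply: (mulfI n0); rewrite mulfV.
Qed.

Lemma signz_succ s : (- 1 : C) ^ (s + 1) = - (- 1) ^ s.
Proof. by rewrite expfzDr ?oppr_eq0 ?oner_eq0 // expr1z mulrN1. Qed.

Definition theta_term q A B s : C := (- 1) ^ s * q ^ (A * s ^+ 2 + B * s).

Lemma theta_termM q A B A' B' s : q != 0 ->
  theta_term q A B s * q ^ (A' * s ^+ 2 + B' * s)
  = theta_term q (A + A') (B + B') s.
Proof.
by move=> q0; rewrite /theta_term -mulrA -expfzDr //; congr (_ * _ ^ _); ring.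
Qed.

Lemma theta_term_anti q A s : theta_term q A A (- 1 - s) = - theta_term q A A s.
Proof.
by rewrite /theta_term signz_pred mulNr; congr (- (_ * _ ^ _)); ring.
Qed.

(** * Bilateral Bailey pairs and the steps of the chain *)

Definition even_ker p (n : nat) s := qpochV p (n%:Z - s) * qpochV p (n%:Z + s).

Definition odd_ker p (n : nat) s := qpochV p (n%:Z - s) * qpochV p (n%:Z + s + 1).

Lemma odd_ker_sym p n s : odd_ker p n (- 1 - s) = odd_ker p n s.
Proof.
by rewrite /odd_ker mulrC; congr (qpochV p _ * qpochV p _); lia.
Qed.

Lemma even_odd_ker p n s : not_root_of_unity p ->
  even_ker p n s = (1 - p ^ (n%:Z + s + 1)) * odd_ker p n s.
Proof.
move=> hp; rewrite /even_ker /odd_ker mulrCA -qpochV_pred //.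
by congr (_ * qpochV p _); lia.
Qed.

Definition ker_supported (K : nat -> int -> C) := forall n t : nat, (n < t)%N ->
  K n t%:Z = 0 /\ K n (- 1 - t%:Z) = 0.

Lemma even_ker_supported p : ker_supported (even_ker p).
Proof.
move=> n t nt; rewrite /even_ker; split.
  by rewrite qpochV_neg ?mul0r //; lia.
by rewrite mulrC qpochV_neg ?mul0r //; lia.
Qed.

Lemma odd_ker_supported p : ker_supported (odd_ker p).
Proof.
move=> n t nt; rewrite /odd_ker; split.
  by rewrite qpochV_neg ?mul0r //; lia.
by rewrite mulrC qpochV_neg ?mul0r //; lia.
Qed.

(** The beta sequence of a Bailey pair, with alpha unfolded over the integers: relative to 1 for
    [even_ker], and relative to p, up to a constant factor, for [odd_ker]. *)
Definition bailey (K : nat -> int -> C) (al : int -> C) (n : nat) : C :=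
  zsum n.+1 (fun s => al s * K n s).

(** The Bailey lemma: after exchanging the sums, the hypothesis says that [K] is reproduced with
    multiplier c(s) v, so the weight acts on [al] by pointwise multiplication by [c]. Finite support
    lets all windows be widened to n + 1. *)
Lemma bailey_step p K (W : nat -> C) (c al : int -> C) (v : C) n :
  ker_supported K ->
  (forall s, \sum_(r < n.+1) qpochV p (n%:Z - r%:Z) * W r * K r s = c s * v * K n s) ->
  \sum_(r < n.+1) qpochV p (n%:Z - r%:Z) * W r * bailey K al r
  = v * bailey K (fun s => al s * c s) n.
Proof.
move=> hK h; rewrite /bailey -zsumZ.
transitivity (\sum_(r < n.+1) zsum n.+1 (fun s =>
    al s * (qpochV p (n%:Z - r%:Z) * W r * K r s))).
  apply: eq_bigr => r _; rewrite (@zsum_widen r.+1 n.+1) //; last first.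
    by move=> t rt; have [-> ->] := hK r t rt; rewrite !mulr0.
  by rewrite -zsumZ; apply: eq_zsum => s; ring.
rewrite -zsum_sum; apply: eq_zsum => s.
by rewrite -big_distrr /= h; ring.
Qed.

Lemma eq_bailey K al al' n : al =1 al' -> bailey K al n = bailey K al' n.
Proof. by move=> h; apply: eq_zsum => s; rewrite h. Qed.

Lemma bailey_even_step q A B n : q != 0 -> not_root_of_unity q ->
  \sum_(r < n.+1) qpochV (q ^+ 2) (n%:Z - r%:Z) * q ^+ (2 * r ^ 2)
     * bailey (even_ker (q ^+ 2)) (theta_term q A B) r
  = bailey (even_ker (q ^+ 2)) (theta_term q (A + 2) B) n.
Proof.
move=> q0 hq; have hp := @not_root_of_unityX _ q 2 hq isT.
under eq_bigr do rewrite exprM.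
rewrite (@bailey_step _ _ (fun r => (q ^+ 2) ^+ (r ^ 2)) _ _ _ _ (@even_ker_supported _)
  (fun s => @kernel_even _ _ n s hp)) mul1r.
apply: eq_bailey => s; rewrite (_ : (q ^+ 2) ^ (s ^+ 2) = q ^ (2 * s ^+ 2 + 0 * s)).
  by rewrite theta_termM // addr0.
by rewrite mul0r addr0 (exprnP q 2) exprz_exp.
Qed.

Lemma bailey_odd_step q A B n : q != 0 -> not_root_of_unity q ->
  \sum_(r < n.+1) qpochV (q ^+ 2) (n%:Z - r%:Z) * q ^+ (2 * (r ^ 2 + r))
     * bailey (odd_ker (q ^+ 2)) (theta_term q A B) r
  = bailey (odd_ker (q ^+ 2)) (theta_term q (A + 2) (B + 2)) n.
Proof.
move=> q0 hq; have hp := @not_root_of_unityX _ q 2 hq isT.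
under eq_bigr do rewrite exprM.
rewrite (@bailey_step _ _ (fun r => (q ^+ 2) ^+ (r ^ 2 + r)) _ _ _ _
  (@odd_ker_supported _) (fun s => @kernel_odd _ _ n s hp)) mul1r.
apply: eq_bailey => s; rewrite (_ : (q ^+ 2) ^ (s ^+ 2 + s) = q ^ (2 * s ^+ 2 + 2 * s)).
  by rewrite theta_termM.
by rewrite (exprnP q 2) exprz_exp; congr (_ ^ _); ring.
Qed.

Lemma bailey_half_even q A B n : q != 0 -> not_root_of_unity q ->
  \sum_(r < n.+1) qpochV (q ^+ 2) (n%:Z - r%:Z)
       * (q ^+ (r ^ 2) * qpoch (- q) (q ^+ 2) r)
     * bailey (even_ker (q ^+ 2)) (theta_term q A B) r
  = qpoch (- q) (q ^+ 2) n
    * bailey (even_ker (q ^+ 2)) (theta_term q (A + 1) B) n.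
Proof.
move=> q0 hq.
rewrite (@bailey_step _ _ (fun r => q ^+ (r ^ 2) * qpoch (- q) (q ^+ 2) r) _ _ _ _
  (@even_ker_supported _) (fun s => @half_kernel_even _ q n s hq)).
congr (_ * _); apply: eq_bailey => s.
rewrite (_ : s ^+ 2 = 1 * s ^+ 2 + 0 * s); last by ring.
by rewrite theta_termM // addr0.
Qed.

(* Both sides differ by a multiple of the sum of an antisymmetric function, as
   even_ker and odd_ker differ by the factor 1 - q^(2(n + s + 1)). *)
Lemma bailey_even_odd q A n : q != 0 -> not_root_of_unity q ->
  bailey (even_ker (q ^+ 2)) (theta_term q A (A - 2)) n
  = bailey (odd_ker (q ^+ 2)) (theta_term q A (A - 2)) n.
Proof.
move=> q0 hq; have hp := @not_root_of_unityX _ q 2 hq isT.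
apply/eqP; rewrite eq_sym -subr_eq0 /bailey -zsumB; apply/eqP.
transitivity (zsum n.+1 (fun s =>
    q ^ (2 * n%:Z + 2) * (theta_term q A A s * odd_ker (q ^+ 2) n s))).
  apply: eq_zsum => s; rewrite even_odd_ker // exprnP exprz_exp.
  have -> : theta_term q A A s = theta_term q A (A - 2) s * q ^ (0 * s ^+ 2 + 2 * s).
    by rewrite theta_termM //; congr theta_term; ring.
  have -> : q ^ (2%:Z * (n%:Z + s + 1)) = q ^ (2 * n%:Z + 2) * q ^ (0 * s ^+ 2 + 2 * s).
    by rewrite -expfzDr //; congr (_ ^ _); ring.
  by ring.
rewrite zsumZ zsum_anti ?mulr0 // => s.
by rewrite theta_term_anti odd_ker_sym mulNr.
Qed.

(* An odd sum turns into an even one: this is the step at N_2 when i = 2. *)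
Lemma bailey_half_odd q A n : q != 0 -> not_root_of_unity q ->
  \sum_(r < n.+1) qpochV (q ^+ 2) (n%:Z - r%:Z)
       * (q ^+ (r ^ 2 + 2 * r) * qpoch (- q) (q ^+ 2) r)
     * bailey (odd_ker (q ^+ 2)) (theta_term q A (A - 2)) r
  = qpoch (- q) (q ^+ 2) n
    * bailey (even_ker (q ^+ 2)) (theta_term q (A + 1) A) n.
Proof.
move=> q0 hq; have hp := @not_root_of_unityX _ q 2 hq isT.
rewrite (@bailey_step _ _ (fun r => q ^+ (r ^ 2 + 2 * r) * qpoch (- q) (q ^+ 2) r)
  _ _ _ _ (@odd_ker_supported _) (fun s => @half_kernel_odd _ q n s q0 hq)).
rewrite qpochSr -mulrA; congr (_ * _).
apply/eqP; rewrite -subr_eq0 /bailey -zsumZ -zsumB; apply/eqP.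
(* The two summands differ by theta(A+1, A+1) e odd_ker: the factor 1 + v comes from (-q;
   q^2)_(n+1), and 1 - v w from [even_odd_ker]. It remains to see that e is invariant under s |-> -1
   - s, where w becomes 1/w and q^(-s) becomes q^(-s) w. *)
pose v := q ^ (2 * n%:Z + 1); pose w s := q ^ (2 * s + 1).
pose e s := q ^ (- s) * ((v - w s + v * w s + v * w s ^+ 2) / (1 + w s)).
transitivity (zsum n.+1 (fun s =>
    theta_term q (A + 1) (A + 1) s * e s * odd_ker (q ^+ 2) n s)).
  apply: eq_zsum => s.
  have h1 : 1 + w s != 0 := onePoddX_neq0 s q0 hq.
  have -> : theta_term q A (A - 2) s * (q ^ (s ^+ 2 + 2 * s) / (1 + q ^ (2 * s + 1)))
      = theta_term q (A + 1) (A + 1) s * q ^ (- s) / (1 + w s).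
    rewrite mulrA (_ : s ^+ 2 + 2 * s = 1 * s ^+ 2 + 2 * s); last by ring.
    rewrite (_ : - s = 0 * s ^+ 2 + (- 1) * s); last by ring.
    rewrite !theta_termM //.
    by congr (theta_term _ _ _ _ / _); ring.
  have -> : theta_term q (A + 1) A s = theta_term q (A + 1) (A + 1) s * q ^ (- s).
    rewrite (_ : - s = 0 * s ^+ 2 + (- 1) * s); last by ring.
    rewrite theta_termM //.
    by congr (theta_term _ _ _ _); ring.
  have -> : - q * q ^+ 2 ^+ n = - v.
    by rewrite mulNr -exprM -exprS /v -exprnP addn1.
  rewrite even_odd_ker // (exprnP q 2) exprz_exp.
  have -> : q ^ (2%:Z * (n%:Z + s + 1)) = v * w s.
    by rewrite /v /w -expfzDr //; congr (_ ^ _); ring.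
  by rewrite /e; field.
apply: zsum_anti => s.
rewrite theta_term_anti odd_ker_sym !mulNr; congr (- (_ * _ * _)).
have h1 : 1 + w s != 0 := onePoddX_neq0 s q0 hq.
have h2 : w s != 0 by rewrite expfz_neq0.
rewrite /e.
have -> : w (- 1 - s) = (w s)^-1.
  by rewrite /w invr_expz; congr (_ ^ _); ring.
have -> : q ^ (- (- 1 - s)) = q ^ (- s) * w s.
  by rewrite /w -expfzDr //; congr (_ ^ _); ring.
by field; rewrite h1 h2.
Qed.

(** * The finite Jacobi triple product and the starting pairs *)

Lemma zsum_reflect M f : f M%:Z = f (- M%:Z) -> zsum M (fun s => f (- s)) = zsum M f.
Proof.
move=> h; rewrite -(@zsum_shift M (fun s => f (- s))) ?opprK //.
apply: eq_bigr => t _; rewrite addrC; congr (f _ + f _); lia.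
Qed.

(** The heights a and c are kept independent so that induction can raise one at a time; the
    reflection s |-> -s exchanges them and inverts z. *)
Definition jacobi_sum y z (M a c : nat) : C := zsum M (fun s =>
  (- 1) ^ s * y ^ (s ^+ 2) * z ^ s
    * (qpochV (y ^+ 2) (a%:Z - s) * qpochV (y ^+ 2) (c%:Z + s))).

Let jacobi_sumC y z M a c : (a < M)%N -> (c < M)%N ->
  jacobi_sum y z M a c = jacobi_sum y z^-1 M c a.
Proof.
move=> aM cM; rewrite /jacobi_sum -zsum_reflect; last first.
  rewrite [qpochV _ (a%:Z - M%:Z)]qpochV_neg; last by lia.
  by rewrite [qpochV _ (_ + - M%:Z)]qpochV_neg ?mul0r ?mulr0 //; lia.
apply: eq_zsum => s; rewrite opprK sqrrN exprz_inv -!invr_expz.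
rewrite [in RHS]mulrC -[in LHS]mulrC [qpochV _ _ * qpochV _ _]mulrC.
by congr (_ * (_ * _ * _)); rewrite invr_expz -exprz_inv invrN invr1.
Qed.

(** With b = y^2, 1 - b^(a+c+1) = (1 - b^(a+1-s)) + b^(a+1-s) (1 - b^(c+s)). Both parts reduce to
    height a, the second one after a shift of s, which brings out -y z b^a. *)
Let jacobi_sum_rec y z (a c M : nat) : y != 0 -> z != 0 ->
  not_root_of_unity (y ^+ 2) -> (a.+1 < M)%N -> (c < M)%N ->
  (1 - (y ^+ 2) ^+ (a + c).+1) * jacobi_sum y z M a.+1 c
  = (1 - y * z * (y ^+ 2) ^+ a) * jacobi_sum y z M a c.
Proof.
move=> y0 z0 hb aM cM; rewrite /jacobi_sum.
set b := y ^+ 2.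
have b0 : b != 0 by rewrite expf_neq0.
pose t s : C := (- 1) ^ s * y ^ (s ^+ 2) * z ^ s.
have tS s : t (s + 1) = - (y * z * b ^ s) * t s.
  rewrite /t signz_succ (_ : (s + 1) ^+ 2 = s ^+ 2 + 2%:Z * s + 1); last by ring.
  by rewrite !expfzDr // /b (exprnP y 2) exprz_exp !expr1z; ring.
pose g s := b ^ (a.+1%:Z - s) * t s
  * (qpochV b (a.+1%:Z - s) * qpochV b (c%:Z + s - 1)).
transitivity (zsum M (fun s => t s * (qpochV b (a%:Z - s) * qpochV b (c%:Z + s))) + zsum M g).
  rewrite -zsumZ -zsumD; apply: eq_zsum => s; rewrite -/(t s) /g.
  rewrite (_ : a%:Z - s = a.+1%:Z - s - 1); last by lia.
  rewrite !qpochV_pred //.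
  have -> : b ^+ (a + c).+1 = b ^ (a.+1%:Z - s) * b ^ (c%:Z + s).
    by rewrite -expfzDr // exprnP; congr (_ ^ _); lia.
  by ring.
rewrite -(@zsum_shift M g); last first.
  rewrite /g [qpochV b (_ - M%:Z)]qpochV_neg; last by lia.
  by rewrite [qpochV b (_ + - M%:Z - 1)]qpochV_neg ?mul0r ?mulr0 //; lia.
rewrite -zsumZ -zsumD; apply: eq_zsum => s; rewrite -/(t s) /g tS.
rewrite (_ : a.+1%:Z - (s + 1) = a%:Z - s); last by lia.
rewrite (_ : c%:Z + (s + 1) - 1 = c%:Z + s); last by lia.
have -> : b ^+ a = b ^ (a%:Z - s) * b ^ s.
  by rewrite -expfzDr // exprnP; congr (_ ^ _); lia.
by ring.
Qed.

Lemma finite_jacobi y z (a c M : nat) : y != 0 -> z != 0 ->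
  not_root_of_unity (y ^+ 2) -> (a < M)%N -> (c < M)%N ->
  zsum M (fun s => (- 1) ^ s * y ^ (s ^+ 2) * z ^ s
    * (qpochV (y ^+ 2) (a%:Z - s) * qpochV (y ^+ 2) (c%:Z + s)))
  = qpoch (y * z) (y ^+ 2) a * qpoch (y / z) (y ^+ 2) c
    / qpoch (y ^+ 2) (y ^+ 2) (a + c).
Proof.
move=> y0 z0 hb; rewrite -/(jacobi_sum y z M a c).
have E (n : nat) : 1 - (y ^+ 2) ^+ n.+1 != 0 by rewrite subr_eq0 eq_sym hb.
have rec x a' c' : x != 0 -> (a'.+1 < M)%N -> (c' < M)%N ->
    jacobi_sum y x M a'.+1 c'
    = (1 - y * x * (y ^+ 2) ^+ a') / (1 - (y ^+ 2) ^+ (a' + c').+1)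
      * jacobi_sum y x M a' c'.
  move=> x0 aM cM; apply: (mulfI (E (a' + c')%N)).
  by rewrite jacobi_sum_rec // mulrA mulrCA mulfV ?mulr1.
elim: a => [|a IHa] aM cM.
  rewrite jacobi_sumC // add0n qpoch0 mul1r.
  elim: c cM => [|c IHc] cM.
    rewrite /jacobi_sum !qpoch0 divr1 -(@zsum_widen 1 M) //; last first.
      move=> u u1; rewrite [qpochV _ (_ - u%:Z)]qpochV_neg; last by lia.
      by rewrite [qpochV _ (_ + (_ - u%:Z))]qpochV_neg ?mul0r ?mulr0 //; lia.
    rewrite /zsum big_ord1 [qpochV _ (_ + (_ - 0))]qpochV_neg //.
    by rewrite subr0 addr0 qpochV0 !mulr0 addr0 expr0n !expr0z !mulr1.
  rewrite rec ?invr_eq0 // IHc ?(ltnW cM) // addn0 !qpochSr -exprS.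
  have := qpochpp_neq0 c hb; have := E c.
  by move=> h1 h2; field; rewrite h1 h2 z0.
rewrite rec // IHa ?(ltnW aM) // addSn !qpochSr -exprS.
have := qpochpp_neq0 (a + c) hb; have := E (a + c)%N.
by move=> h1 h2; field; rewrite h1 h2.
Qed.

(** Take y = z = q in [finite_jacobi]: the factor (y/z; q^2)_n = (1; q^2)_n vanishes for n > 0. *)
Lemma bailey_unit q n : q != 0 -> not_root_of_unity q ->
  bailey (even_ker (q ^+ 2)) (theta_term q 1 1) n = (n == 0%N)%:R.
Proof.
move=> q0 hq; have hp := @not_root_of_unityX _ q 2 hq isT.
have := @finite_jacobi q q n n n.+1 q0 q0 hp (ltnSn n) (ltnSn n).
rewrite mulfV // => e; transitivity (qpoch (q * q) (q ^+ 2) n * qpoch 1 (q ^+ 2) n /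
      qpoch (q ^+ 2) (q ^+ 2) (n + n)).
  rewrite -e; apply: eq_zsum => s; rewrite /theta_term /even_ker; congr (_ * _).
  by rewrite -mulrA -expfzDr // !mul1r.
case: n {e} => [|n]; first by rewrite !qpoch0 mulr1 divr1.
by rewrite [qpoch 1 _ _]qpochS subrr mul0r mulr0 mul0r.
Qed.

(** The exponent 2 s^2 is twice what [finite_jacobi] allows over the base q^2, so a first-order
    recurrence in n is proved by telescoping instead. *)
Lemma bailey_gauss q n : q != 0 -> not_root_of_unity q ->
  bailey (even_ker (q ^+ 2)) (theta_term q 2 0) n = (qpoch (q ^+ 4) (q ^+ 4) n)^-1.
Proof.
move=> q0 hq; have hp := @not_root_of_unityX _ q 2 hq isT.
have h4 := @not_root_of_unityX _ q 4 hq isT.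
have p0 : q ^+ 2 != 0 by rewrite expf_neq0.
elim: n => [|n IHn].
  rewrite /bailey /zsum big_ord1 qpoch0 /even_ker /theta_term invr1.
  rewrite [qpochV _ (_ + (_ - 0))]qpochV_neg // subr0 addr0 qpochV0 mulr0 mulr0 addr0.
  by rewrite mulr0 addr0 !expr0z !mulr1.
have E : 1 - q ^+ 4 ^+ n.+1 != 0 by rewrite subr_eq0 eq_sym h4.
apply: (mulfI E); rewrite qpochSr -exprS invfM mulrCA mulfV ?mulr1 // -{}IHn.
set p := q ^+ 2; set N := n.+1.
apply/eqP; rewrite -subr_eq0; apply/eqP.
have -> : bailey (even_ker p) (theta_term q 2 0) n =
    zsum n.+2 (fun s => theta_term q 2 0 s * even_ker p n s).
  rewrite /bailey (@zsum_widen n.+1 n.+2) // => t nt.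
  by have [-> ->] := @even_ker_supported p _ _ nt; rewrite !mulr0.
rewrite /bailey -zsumZ -zsumB.
(* Telescoping certificate: (1 - q^(4N)) times the summand at N, minus the summand at N - 1, is f(s)
   - f(s+1). *)
pose f s := p ^ (N%:Z - s) * theta_term q 2 0 s
   * (qpochV p (N%:Z - s) * qpochV p (N%:Z + s - 1)).
transitivity (zsum N.+1 f + zsum N.+1 (fun s => - f (s + 1))).
  rewrite -zsumD; apply: eq_zsum => s; rewrite /f /even_ker.
  rewrite (_ : n%:Z - s = N%:Z - s - 1); last by lia.
  rewrite (_ : n%:Z + s = N%:Z + s - 1); last by lia.
  rewrite (_ : N%:Z - (s + 1) = N%:Z - s - 1); last by lia.
  rewrite (_ : N%:Z + (s + 1) - 1 = N%:Z + s); last by lia.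
  rewrite !qpochV_pred //.
  have -> : theta_term q 2 0 (s + 1) = - (p ^ s * p ^ s * p * theta_term q 2 0 s).
    rewrite /theta_term signz_succ /p (exprnP q 2) !exprz_exp !mul0r !addr0.
    rewrite (_ : 2 * (s + 1) ^+ 2 = 2%:Z * s + 2%:Z * s + 2%:Z + 2 * s ^+ 2); last by ring.
    by rewrite !expfzDr //; ring.
  have -> : q ^+ 4 ^+ N = p ^ (N%:Z - s) * p ^ (N%:Z - s) * (p ^ s * p ^ s).
    rewrite /p (exprnP q 2) !exprz_exp -!expfzDr // -exprM exprnP; congr (_ ^ _); lia.
  have -> : p ^ (N%:Z + s) = p ^ (N%:Z - s) * (p ^ s * p ^ s).
    by rewrite -!expfzDr //; congr (_ ^ _); lia.
  have -> : p ^ (N%:Z - s - 1) = p ^ (N%:Z - s) / p.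
    by rewrite expfzDr.
  by field.
rewrite -(@zsum_shift _ f) ?zsumD; last first.
  rewrite /f [qpochV p (_ - N.+1%:Z)]qpochV_neg; last by lia.
  by rewrite [qpochV p (_ + - N.+1%:Z - 1)]qpochV_neg ?mul0r ?mulr0 //; lia.
by rewrite -zsumD; rewrite /zsum big1 // => t _; rewrite !subrr addr0.
Qed.

(** For j = 1 a single step from the unit pair, of which only the term r = 0 survives, yields
    1/(q^2; q^2)_n. *)
Lemma bailey_start q (j : nat) n : (j <= 1)%N -> q != 0 -> not_root_of_unity q ->
  bailey (even_ker (q ^+ 2)) (theta_term q (2 + j%:Z) j%:Z) n
  = (qpoch (q ^+ (4 - 2 * j)) (q ^+ (4 - 2 * j)) n)^-1.
Proof.
move=> + q0 hq; have hp := @not_root_of_unityX _ q 2 hq isT.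
case: j => [_|[|//] _]; first by rewrite addr0 bailey_gauss.
rewrite (_ : 4 - 2 * 1 = 2)%N // [2 + _]addrC -bailey_even_step //.
rewrite big_ord_recl big1 => [|r _]; last by rewrite bailey_unit // mulr0.
by rewrite bailey_unit // expr0 subr0 addr0 !mulr1.
Qed.

End BilateralSums.

(** * Sums over chains *)

(** The bound n acts as a part N_0, and each entry bounds the rest of the list, so induction peels
    off the largest part. *)
Fixpoint chain_seqs (r n : nat) : seq (seq nat) :=
  if r is r'.+1 then [seq a :: l | a <- iota 0 n.+1, l <- chain_seqs r' a]
  else [:: [::]].

Lemma chain_seqsS r n : chain_seqs r.+1 n
  = [seq a :: l | a <- iota 0 n.+1, l <- chain_seqs r a].
Proof. by []. Qed.

Lemma mem_chain_seqs r n l :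
  (l \in chain_seqs r n) = (size l == r) && path geq n l.
Proof.
elim: r n l => [|r IHr] n [|a l] //; rewrite chain_seqsS.
  by apply/allpairsPdep => -[? [? []]].
apply/allpairsPdep/andP => [[b [l' [+ + [-> ->]]]]|[]].
  by rewrite mem_iota add0n ltnS IHr /= eqSS => bn /andP[-> ->]; rewrite bn.
rewrite eqSS => sl /andP[an pl]; exists a, l; split => //.
  by rewrite mem_iota.
by rewrite IHr sl.
Qed.

Lemma uniq_chain_seqs r n : uniq (chain_seqs r n).
Proof.
elim: r n => [|r IHr] n //; rewrite chain_seqsS.
apply: allpairs_uniq_dep => [|a _|]; rewrite ?iota_uniq //.
by move=> [a l] [b l'] _ _ /= [-> ->].
Qed.

Lemma sum_chain_seqs (V : nmodType) (F : seq nat -> V) r n :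
  \sum_(l <- chain_seqs r.+1 n) F l
  = \sum_(a < n.+1) \sum_(l <- chain_seqs r a) F (nat_of_ord a :: l).
Proof.
rewrite chain_seqsS big_allpairs_dep /=.
by rewrite -(big_mkord xpredT (fun a => \sum_(l <- chain_seqs r a) F (a :: l))) /index_iota subn0.
Qed.

Section ChainSums.
Context {C : numFieldType}.
Implicit Types (p q : C) (n m r : nat).

Fixpoint chain_weight p (w : nat -> nat -> C) (g : nat -> C) n m (l : seq nat) : C :=
  if l is a :: l' then
    qpochV p (n%:Z - a%:Z) * w m a * chain_weight p w g a m.+1 l'
  else g n.

Lemma sum_chain_weight p w g n m r :
  \sum_(l <- chain_seqs r.+1 n) chain_weight p w g n m l
  = \sum_(a < n.+1) qpochV p (n%:Z - a%:Z) * w m a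
      * \sum_(l <- chain_seqs r a) chain_weight p w g a m.+1 l.
Proof.
by rewrite sum_chain_seqs; apply: eq_bigr => a _; rewrite big_distrr.
Qed.

(* The levels are numbered from 0: level m carries N_(m+1). *)
Definition level_weight q (i m a : nat) : C :=
  (if m is m'.+1 then
     (if m' is 0%N then q ^+ (a ^ 2) * qpoch (- q) (q ^+ 2) a else q ^+ (2 * a ^ 2))
     * (if (i <= m.+1)%N then q ^+ (2 * a) else 1)
   else q ^+ (2 * a ^ 2) / qpoch (- q) (q ^+ 2) a).

Definition last_weight q (j n : nat) : C :=
  (qpoch (q ^+ (4 - 2 * j)) (q ^+ (4 - 2 * j)) n)^-1.

Section Levels.
Variables (q : C) (j k i : nat).
Hypotheses (q0 : q != 0) (hq : not_root_of_unity q) (hj : (j <= 1)%N)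
  (hik : (i <= k)%N) (hi : (2 <= i)%N) (hkj : (4 < 2 * k + j)%N).

(** The r innermost summations below the bound n, the outermost of them at level m; below, m + r = k
    - 1 throughout. *)
Let S n m r :=
  \sum_(l <- chain_seqs r n)
    chain_weight (q ^+ 2) (level_weight q i) (last_weight q j) n m l.

Let bl K A B n : C := bailey (K (q ^+ 2)) (theta_term q A B) n.

Let S0 n m : S n m 0 = bl even_ker (2 + j%:Z) j%:Z n.
Proof. by rewrite /S /= big_seq1 /= /last_weight -bailey_start. Qed.

(** The bounds on r say that all levels involved lie beyond N_2 and carry a linear term. Since B = A
    - 2, the even sum may be read as an odd one; the odd step raises A and B together, so it can be
    read back as an even one. *)
Let S_linear n r : (r + 3 <= k)%N -> (r + i <= k)%N ->
  S n (k.-1 - r) r = bl even_ker (2 + j%:Z + 2 * r%:Z) (j%:Z + 2 * r%:Z) n.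
Proof.
elim: r n => [|r IHr] n kr ir; first by rewrite S0 /bl mulr0 !addr0.
rewrite /S sum_chain_weight -/(S _ _).
transitivity (\sum_(a < n.+1) qpochV (q ^+ 2) (n%:Z - a%:Z) * q ^+ (2 * (a ^ 2 + a))
    * bl odd_ker (2 + j%:Z + 2 * r%:Z) (2 + j%:Z + 2 * r%:Z - 2) a).
  apply: eq_bigr => a _; congr (_ * _ * _).
    case em: (k.-1 - r.+1)%N => [|[|m]]; try lia.
    by rewrite /level_weight ifT; [rewrite mulnDr exprD|lia].
  rewrite /bl -bailey_even_odd // -/(S _ _ _).
  rewrite (_ : (k.-1 - r.+1).+1 = k.-1 - r)%N; last by lia.
  by rewrite IHr; [congr (bailey _ (theta_term _ _ _)); ring|lia|lia].
rewrite /bl bailey_odd_step //.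
rewrite (_ : 2 + j%:Z + 2 * r%:Z + 2 = 2 + j%:Z + 2 * r.+1%:Z); last by lia.
rewrite (_ : _ - 2 + 2 = 2 + j%:Z + 2 * r.+1%:Z - 2); last by lia.
rewrite -bailey_even_odd //; congr (bailey _ (theta_term _ _ _)); lia.
Qed.

Let S_plain n d : (3 <= i)%N -> (d + 3 <= i)%N ->
  S n (k.-1 - (k - i + d)) (k - i + d)
  = bl even_ker (2 + j%:Z + 2 * (k - i + d)%:Z) (j%:Z + 2 * (k - i)%:Z) n.
Proof.
move=> i3; elim: d n => [|d IHd] n di; first by rewrite addn0 S_linear //; lia.
rewrite addnS /S sum_chain_weight.
transitivity (\sum_(a < n.+1) qpochV (q ^+ 2) (n%:Z - a%:Z) * q ^+ (2 * a ^ 2)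
    * bl even_ker (2 + j%:Z + 2 * (k - i + d)%:Z) (j%:Z + 2 * (k - i)%:Z) a).
  apply: eq_bigr => a _; congr (_ * _ * _).
    case em: (k.-1 - (k - i + d).+1)%N => [|[|m]]; try lia.
    by rewrite /level_weight ifF ?mulr1 //; lia.
  rewrite -/(S _ _ _) (_ : (k.-1 - (k - i + d).+1).+1 = k.-1 - (k - i + d))%N; last by lia.
  by rewrite IHd //; lia.
rewrite /bl bailey_even_step //; congr (bailey _ (theta_term _ _ _)); lia.
Qed.

(** The step at N_2 is entered with A = 2k + j - 4. For i > 2 it leaves B alone; for i = 2 it also
    absorbs a linear term, and B = A - 2 is what [bailey_half_odd] requires. *)
Let S_half n : (3 <= k)%N ->
  S n 1 k.-2 = qpoch (- q) (q ^+ 2) n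
    * bl even_ker ((2 * k + j)%:Z - 3) ((2 * k + j)%:Z - 2 * i%:Z) n.
Proof.
move=> k3; rewrite /S (_ : k.-2 = (k - 3).+1); last by lia.
rewrite sum_chain_weight; have [i3|i2] := ltnP 2 i.
  transitivity (\sum_(a < n.+1) qpochV (q ^+ 2) (n%:Z - a%:Z)
      * (q ^+ (a ^ 2) * qpoch (- q) (q ^+ 2) a)
      * bl even_ker ((2 * k + j)%:Z - 4) ((2 * k + j)%:Z - 2 * i%:Z) a).
    apply: eq_bigr => a _; congr (_ * _ * _).
      by rewrite /level_weight ifF ?mulr1 //; lia.
    have := @S_plain a (i - 3) i3; rewrite (_ : k - i + (i - 3) = k - 3)%N; last by lia.
    rewrite (_ : k.-1 - (k - 3) = 2)%N; last by lia.
    rewrite /S => ->; last by lia.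
    congr (bailey _ (theta_term _ _ _)); lia.
  rewrite /bl bailey_half_even //; congr (_ * bailey _ (theta_term _ _ _) _); lia.
have {i2}i2 : i = 2%N by lia.
transitivity (\sum_(a < n.+1) qpochV (q ^+ 2) (n%:Z - a%:Z)
    * (q ^+ (a ^ 2 + 2 * a) * qpoch (- q) (q ^+ 2) a)
    * bl odd_ker ((2 * k + j)%:Z - 4) ((2 * k + j)%:Z - 4 - 2) a).
  apply: eq_bigr => a _; congr (_ * _ * _).
    by rewrite /level_weight i2 /= exprD; ring.
  have := @S_linear a (k - 3); rewrite (_ : k.-1 - (k - 3) = 2)%N; last by lia.
  rewrite /S => ->; [|lia|lia].
  rewrite /bl -bailey_even_odd //; congr (bailey _ (theta_term _ _ _)); lia.
rewrite /bl bailey_half_odd // i2; congr (_ * bailey _ (theta_term _ _ _) _); lia.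
Qed.

Let S_below_first n : S n 1 k.-2 = qpoch (- q) (q ^+ 2) n
    * bl even_ker ((2 * k + j)%:Z - 3) ((2 * k + j)%:Z - 2 * i%:Z) n.
Proof.
have [k3|k2] := leqP 3 k; first exact: S_half.
have [ej [ek ei]] : j = 1%N /\ k = 2%N /\ i = 2%N by lia.
rewrite ej ek ei; transitivity (qpochV (q ^+ 2) n%:Z).
  by rewrite /S /= big_seq1 /= /last_weight ej.
(* There is no N_2 when k = 2; the half step applied to the unit pair, where only r = 0 contributes,
   still gives the stated form. *)
have := @bailey_half_even _ q 1 1 n q0 hq.
rewrite big_ord_recl big1 => [|r _]; last by rewrite bailey_unit // mulr0.
by rewrite bailey_unit // expr0 qpoch0 subr0 addr0 !mulr1.
Qed.

Lemma bailey_chain_sum n :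
  \sum_(l <- chain_seqs k.-1 n)
    chain_weight (q ^+ 2) (level_weight q i) (last_weight q j) n 0 l
  = bailey (even_ker (q ^+ 2))
      (theta_term q ((2 * k + j)%:Z - 1) ((2 * k + j)%:Z - 2 * i%:Z)) n.
Proof.
have -> : k.-1 = k.-2.+1 by lia.
have -> : (2 * k + j)%:Z - 1 = (2 * k + j)%:Z - 3 + 2 by lia.
rewrite sum_chain_weight -bailey_even_step //; apply: eq_bigr => a _.
rewrite -/(S a 1 k.-2) S_below_first /level_weight mulrA; congr (_ * _).
rewrite -!mulrA mulVf ?mulr1 //; apply: qpoch_neq0 => l.
rewrite -exprM mulNr -exprS; apply: contraNN (onePoddX_neq0 l q0 hq) => /eqP e.
rewrite -(mulN1r (_ ^+ _)) in e; rewrite -[2 * l%:Z + 1]/((2 * l + 1)%N%:Z) addn1.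
by rewrite -exprnP -e mulN1r addNr.
Qed.
End Levels.
End ChainSums.

(** * Passage to the limit *)

Section ComplexSequences.
Context {R : realType}.
Local Notation C := (R[i] : numFieldType).
Local Notation toC := (real_complex R).
Implicit Types (s K e : C) (u : nat -> C).

Lemma nonneg_toC s : 0 <= s -> toC (complex.Re s) = s.
Proof. by move=> s0; rewrite RRe_real // ger0_real. Qed.

Lemma normc_ge_Im (z : C) : toC `|complex.Im z| <= `|z|.
Proof.
by rewrite normc_def lecR -sqrtr_sqr ler_wsqrtr // lerDr sqr_ge0.
Qed.

Lemma normc_le_ReIm (z : C) : `|z| <= toC (`|complex.Re z| + `|complex.Im z|).
Proof.
rewrite [z in `|z|]complexE (le_trans (ler_normD _ _)) // rmorphD /=.
rewrite normrM normCi mul1r lerD //.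
  by rewrite normc_def /= expr0n addr0 sqrtr_sqr.
by rewrite normc_def /= expr0n addr0 sqrtr_sqr.
Qed.

Lemma geometric_small s K e : 0 <= s < 1 -> 0 <= K -> 0 < e ->
  \forall n \near \oo, K * s ^+ n < e.
Proof.
move=> /andP[s0 s1] K0 e0.
have e0' : 0 < complex.Re e by rewrite -ltcR nonneg_toC // ltW.
have s0' : 0 <= complex.Re s by rewrite -lecR nonneg_toC.
have s1' : complex.Re s < 1 by rewrite -ltcR nonneg_toC.
have := @cvg_geometric R (complex.Re K) (complex.Re s).
rewrite ger0_norm // => /(_ s1') /cvgrPdist_lt /(_ _ e0'); apply: filterS => n.
rewrite sub0r normrN => /(le_lt_trans (ler_norm _)) h.
rewrite -(nonneg_toC s0) -(nonneg_toC K0) -(nonneg_toC (ltW e0)).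
by rewrite -rmorphXn -rmorphM ltcR.
Qed.

(** Real and imaginary parts are treated separately: their telescoped increments are dominated by a
    real geometric series. *)
Lemma geometric_increments_cvg u s K : 0 <= s < 1 -> 0 <= K ->
  (forall n, `|u n.+1 - u n| <= K * s ^+ n) -> cvg (u @ \oo).
Proof.
move=> s01 K0 hu; have /andP[s0 s1] := s01.
have s0' : 0 <= complex.Re s by rewrite -lecR nonneg_toC.
have s1' : complex.Re s < 1 by rewrite -ltcR nonneg_toC.
have hs n : K * s ^+ n = toC (complex.Re K * complex.Re s ^+ n).
  by rewrite rmorphM rmorphXn /= !nonneg_toC.
have real_cvg (v : nat -> R) :
    (forall n, toC `|v n.+1 - v n| <= `|u n.+1 - u n|) -> cvgn v.
  move=> hv; have -> : v = fun n => v 0%N + series (telescope v) n.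
    by apply/funext => n; exact: eq_sum_telescope.
  apply: is_cvgD; first exact: is_cvg_cst.
  apply: normed_cvg; apply: (@series_le_cvg _ _ (geometric (complex.Re K) (complex.Re s))).
  - by move=> n /=; exact: normr_ge0.
  - by move=> n; rewrite geometric_ge0 // -lecR nonneg_toC.
  - by move=> n; rewrite -lecR -hs (le_trans (hv n)) // hu.
  - by apply: is_cvg_geometric_series; rewrite ger0_norm.
have /real_cvg cRe n : toC `|complex.Re (u n.+1) - complex.Re (u n)| <= `|u n.+1 - u n|.
  by rewrite -raddfB normc_ge_Re.
have /real_cvg cIm n : toC `|complex.Im (u n.+1) - complex.Im (u n)| <= `|u n.+1 - u n|.
  by rewrite -raddfB normc_ge_Im.
apply/cvg_ex; exists (lim ((fun n => complex.Re (u n)) @ \oo) +i*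
  lim ((fun n => complex.Im (u n)) @ \oo))%C.
apply/cvgrPdist_lt => e e0.
have e0' : 0 < complex.Re e / 2.
  by rewrite divr_gt0 // -ltcR nonneg_toC // ltW.
move/cvgrPdist_lt: cRe => /(_ _ e0') cRe; move/cvgrPdist_lt: cIm => /(_ _ e0') cIm.
near=> n; rewrite (le_lt_trans (normc_le_ReIm _)) //.
rewrite -(nonneg_toC (ltW e0)) ltcR [ltRHS]splitr !raddfB /= ltrD //.
  by near: n.
by near: n.
Unshelve. all: by end_near. Qed.
End ComplexSequences.

(** * Dominated convergence and infinite products *)

Section Limits.
(* The only two properties of the field R[i] that the limits rely on. *)
Variable C : numFieldType.
Hypothesis geometric_small : forall s K e : C, 0 <= s < 1 -> 0 <= K -> 0 < e ->
  \forall n \near \oo, K * s ^+ n < e.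
Hypothesis geometric_increments_cvg : forall (u : nat -> C) (s K : C),
  0 <= s < 1 -> 0 <= K ->
  (forall n, `|u n.+1 - u n| <= K * s ^+ n) -> cvg (u @ \oo).
Implicit Types (s K e a p q : C) (u : nat -> C).

Lemma geometric_sum_le s m n : 0 <= s < 1 ->
  \sum_(m <= i < n) s ^+ i <= s ^+ m / (1 - s).
Proof.
move=> /andP[s0 s1]; rewrite ler_pdivlMr ?subr_gt0 //.
have [mn|nm] := leqP m n; last by rewrite big_geq ?mul0r ?exprn_ge0 // ltnW.
suff -> : (\sum_(m <= i < n) s ^+ i) * (1 - s) = s ^+ m - s ^+ n.
  by rewrite gerBl exprn_ge0.
elim: n mn => [|n IHn] mn.
  by move: mn; rewrite leqn0 => /eqP ->; rewrite big_geq // mul0r subrr.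
move: mn; rewrite leq_eqVlt => /orP[/eqP ->|]; first by rewrite big_geq // mul0r subrr.
by rewrite ltnS => mn; rewrite big_nat_recr //= mulrDl IHn // exprS; ring.
Qed.

Lemma sum_cvg0 (f : nat -> nat -> C) M : (forall m, f n m @[n --> \oo] --> 0) ->
  \sum_(m < M) f n m @[n --> \oo] --> 0.
Proof.
move=> h; elim: M => [|M IHM].
  have -> : (fun n => \sum_(m < 0) f n m) = cst 0.
    by apply/funext => n; rewrite big_ord0.
  exact: cvg_cst.
have -> : (fun n => \sum_(m < M.+1) f n m) = (fun n => \sum_(m < M) f n m) + f^~ M.
  by apply/funext => n; rewrite big_ord_recr.
by rewrite -[X in _ --> X]addr0; apply: cvgD.
Qed.

(** Discrete dominated convergence: beyond a fixed M the differences contribute at most 2 K s^M / (1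
    - s), and the finite head converges termwise. *)
Lemma tannery (f : nat -> nat -> C) (g : nat -> C) s K (theta : C) :
  0 <= s < 1 -> 0 <= K ->
  (forall n m, `|f n m| <= K * s ^+ m) -> (forall m, `|g m| <= K * s ^+ m) ->
  (forall m, f n m @[n --> \oo] --> g m) ->
  \sum_(m < n) g m @[n --> \oo] --> theta ->
  \sum_(m < n.+1) f n m @[n --> \oo] --> theta.
Proof.
move=> s01 K0 hf hg fg gt; have /andP[s0 s1] := s01.
have s10 : 0 < 1 - s by rewrite subr_gt0.
suff d0 : \sum_(m < n.+1) (f n m - g m) @[n --> \oo] --> 0.
  have -> : (fun n => \sum_(m < n.+1) f n m)
      = (fun n => \sum_(m < n.+1) (f n m - g m) + \sum_(m < n.+1) g m).
    by apply/funext => n; rewrite -big_split /=; apply: eq_bigr => m _; rewrite subrK.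
  rewrite -[theta]add0r; apply: cvgD => //.
  by rewrite (cvg_shiftS (fun n => \sum_(m < n) g m)).
apply/cvgrPdist_lt => e e0.
have e2 : 0 < e / 2 by rewrite divr_gt0.
have K2 : 0 <= 2 * K / (1 - s) by rewrite divr_ge0 ?mulr_ge0 ?(ltW s10).
have [M _ /(_ M (leqnn M)) hM] := geometric_small s01 K2 e2.
have c0 m : f n m - g m @[n --> \oo] --> 0.
  by rewrite -(subrr (g m)); apply: cvgB => //; exact: cvg_cst.
have /cvgrPdist_lt /(_ _ e2) head := @sum_cvg0 (fun n m => f n m - g m) M c0.
near=> n.
have Mn : (M <= n.+1)%N by apply: leqW; near: n; exact: nbhs_infty_ge.
rewrite sub0r normrN -(big_mkord xpredT (fun m => f n m - g m)).
rewrite (@big_cat_nat _ _ _ M) //= (le_lt_trans (ler_normD _ _)) // [ltRHS]splitr.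
rewrite ltrD //.
  rewrite big_mkord.
  have : `|0 - \sum_(m < M) (f n m - g m)| < e / 2 by near: n.
  by rewrite sub0r normrN.
apply: le_lt_trans hM; apply: le_trans (ler_norm_sum _ _ _) _.
apply: (@le_trans _ _ (\sum_(M <= m < n.+1) 2 * K * s ^+ m)).
  apply: ler_sum => m _; rewrite (le_trans (ler_normB _ _)) //.
  by rewrite mulr_natl mulrnAl mulr2n lerD.
rewrite -big_distrr -[leRHS]mulrA /= ler_wpM2l ?mulr_ge0 //.
by rewrite mulrC geometric_sum_le.
Unshelve. all: by end_near. Qed.

(** By induction the product of the 1 + x_l times 1 minus the sum of the x_l is at most 1, and the
    second factor is at least 1/2. *)
Lemma prod_1p_small (x : nat -> C) n : (forall l, 0 <= x l) ->
  (forall n, \sum_(l < n) x l <= 2^-1) -> \prod_(l < n) (1 + x l) <= 2.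
Proof.
move=> x0 hx; have h2 : 2^-1 <= 1 - \sum_(l < n) x l.
  by rewrite lerBrDr [leRHS](splitr 1) div1r lerD2l.
rewrite -(ler_pM2r (_ : 0 < 2^-1)) // divff //.
apply: (@le_trans _ _ ((\prod_(l < n) (1 + x l)) * (1 - \sum_(l < n) x l))).
  by rewrite ler_wpM2l // prodr_ge0 // => l _; rewrite addr_ge0.
elim: n {h2} => [|n IHn]; first by rewrite !big_ord0 subr0 mulr1.
apply: le_trans IHn; rewrite !big_ord_recr /= -mulrA ler_wpM2l //.
  by rewrite prodr_ge0 // => l _; rewrite addr_ge0.
set S := \sum_(l < n) x l; rewrite -subr_ge0.
rewrite (_ : _ - _ = x n * (S + x n)); last by ring.
by rewrite mulr_ge0 ?addr_ge0 ?sumr_ge0.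
Qed.

(** Past some L the geometric tail sums to less than 1/2, so the remaining factors contribute at
    most 2. Extending n to L + n only increases the majorant and spares a comparison of n with L. *)
Lemma prod_bounded (x : nat -> C) c s : 0 <= c -> 0 <= s < 1 ->
  (forall l, `|x l| <= 1 + c * s ^+ l) ->
  exists2 K : C, 0 < K & forall n, `|\prod_(l < n) x l| <= K.
Proof.
move=> c0 s01 hx; have /andP[s0 s1] := s01.
have s10 : 0 < 1 - s by rewrite subr_gt0.
have cs0 l : 0 <= c * s ^+ l by rewrite mulr_ge0 ?exprn_ge0.
have P0 n : 0 < \prod_(l < n) (1 + c * s ^+ l).
  by rewrite prodr_gt0 // => l _; rewrite ltr_pwDl.
have cs : 0 <= c / (1 - s) by rewrite divr_ge0 // ltW.
have h2 : 0 < 2^-1 :> C by rewrite invr_gt0.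
have [L _ /(_ L (leqnn L)) hL] := geometric_small s01 cs h2.
exists ((\prod_(l < L) (1 + c * s ^+ l)) * 2); first by rewrite mulr_gt0.
move=> n; apply: (@le_trans _ _ (\prod_(l < n) (1 + c * s ^+ l))).
  by rewrite normr_prod ler_prod // => l _; rewrite normr_ge0 hx.
apply: (@le_trans _ _ (\prod_(l < L + n) (1 + c * s ^+ l))).
  rewrite addnC big_split_ord /= ler_peMr ?(ltW (P0 n)) //.
  elim: L {hL} => [|L IHL]; first by rewrite big_ord0.
  by rewrite big_ord_recr /= mulr_ege1 // lerDl.
rewrite big_split_ord /= ler_pM2l ?P0 //; apply: (@prod_1p_small (fun l => c * s ^+ (L + l))).
  by move=> l; exact: cs0.
move=> m; apply: le_trans (ltW hL).
under eq_bigr do rewrite exprD mulrA; rewrite -big_distrr /= [leRHS]mulrAC.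
rewrite ler_wpM2l //; have := geometric_sum_le 0 m s01.
by rewrite big_mkord expr0 div1r.
Qed.

Lemma qpoch_bounded a q : `|q| < 1 ->
  exists2 K : C, 0 < K & forall n, `|qpoch a q n| <= K.
Proof.
move=> q1; apply: (@prod_bounded (fun l => 1 - a * q ^+ l) `|a| `|q|) => //.
  by rewrite normr_ge0.
by move=> l; rewrite (le_trans (ler_normB _ _)) // normr1 normrM normrX.
Qed.

Lemma qpoch_cvg a q : `|q| < 1 -> qpoch a q n @[n --> \oo] --> qpoch_inf a q.
Proof.
move=> q1; have [K K0 hK] := qpoch_bounded a q1.
suff : cvg (qpoch a q n @[n --> \oo]) by [].
apply: (@geometric_increments_cvg _ `|q| (K * `|a|)).
- by rewrite normr_ge0.
- by rewrite mulr_ge0 // ltW.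
move=> n; rewrite qpochSr mulrBr mulr1 addrAC subrr add0r normrN !normrM normrX mulrA.
by rewrite ler_wpM2r ?exprn_ge0 // ler_wpM2r.
Qed.

Lemma norm_1subaX_gt0 a q l : `|a| < 1 -> `|q| < 1 -> 0 < 1 - `|a| * `|q| ^+ l.
Proof.
move=> a1 q1; rewrite subr_gt0; apply: le_lt_trans a1.
by rewrite ler_piMr // exprn_ile1 // ltW.
Qed.

Lemma qpochV_bounded a q : `|a| < 1 -> `|q| < 1 ->
  exists2 K : C, 0 < K & forall n, `|(qpoch a q n)^-1| <= K.
Proof.
move=> a1 q1; have a0 : 0 < 1 - `|a| by rewrite subr_gt0.
suff [K K0 hK] : exists2 K : C, 0 < K &
    forall n, `|\prod_(l < n) (1 - a * q ^+ l)^-1| <= K.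
  by exists K => // n; rewrite /qpoch -prodfV.
(* The constant comes from 1/(1 - x) = 1 + x/(1 - x) with x = |a| |q|^l <= |a|. *)
apply: (@prod_bounded (fun l => (1 - a * q ^+ l)^-1) (`|a| / (1 - `|a|)) `|q|).
- by rewrite divr_ge0 // ltW.
- by rewrite normr_ge0.
move=> l; set x := `|a| * `|q| ^+ l.
have x0 : 0 < 1 - x := norm_1subaX_gt0 l a1 q1.
have xa : x <= `|a| by rewrite ler_piMr // exprn_ile1 // ltW.
have x_ge0 : 0 <= x by rewrite mulr_ge0 ?exprn_ge0.
rewrite normfV; apply: (@le_trans _ _ (1 - x)^-1).
  have h : 1 - x <= `|1 - a * q ^+ l|.
    by rewrite /x -normrX -normrM -{1}(normr1 C) lerB_dist.
  by rewrite lef_pV2 ?posrE // (lt_le_trans x0).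
have -> : (1 - x)^-1 = 1 + x / (1 - x) by field; rewrite gt_eqF.
rewrite lerD2l [leRHS]mulrAC -/x ler_wpM2l // lef_pV2 ?posrE // lerD2l lerN2 //.
Qed.

(** The inverses of the partial products are bounded by K, so the products stay at distance at least
    1/K from 0. *)
Lemma qpoch_inf_neq0 a q : `|a| < 1 -> `|q| < 1 -> qpoch_inf a q != 0.
Proof.
move=> a1 q1; have [K K0 hK] := qpochV_bounded a1 q1.
apply/eqP => h; have /cvgrPdist_lt := @qpoch_cvg a q q1.
have K'0 : 0 < K^-1 by rewrite invr_gt0.
rewrite h => /(_ _ K'0) [n _ /(_ n (leqnn n))] /=.
rewrite sub0r normrN => lt; have := hK n.
have P0 : qpoch a q n != 0.
  apply: qpoch_neq0 => l; apply/eqP => e; have := norm_1subaX_gt0 l a1 q1.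
  by rewrite -normrX -normrM e normr1 subrr ltxx.
rewrite normfV -[K]invrK lef_pV2 ?posrE ?normr_gt0 // => le.
by have := lt_le_trans lt le; rewrite ltxx.
Qed.

Lemma norm_lt1_not_root_of_unity q : `|q| < 1 -> not_root_of_unity q.
Proof.
move=> q1 n n0; apply/eqP => h; have : `|q| ^+ n < 1 by rewrite exprn_ilt1 // -lt0n.
by rewrite -normrX h normr1 ltxx.
Qed.

Lemma cvg_along u (phi : nat -> nat) (l : C) : (forall n, (n <= phi n)%N) ->
  u n @[n --> \oo] --> l -> u (phi n) @[n --> \oo] --> l.
Proof.
move=> hphi h A /h [N _ hN]; exists N => // n /= Nn.
by apply: hN => /=; exact: leq_trans (hphi n).
Qed.

Lemma qpochVz_bounded p : `|p| < 1 ->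
  exists2 K : C, 0 < K & forall z, `|qpochV p z| <= K.
Proof.
move=> p1; have [K K0 hK] := qpochV_bounded p1 p1.
by exists K => // -[n|n]; [exact: hK|rewrite normr0 ltW].
Qed.

Lemma qpochVz_cvg p (z : int) : `|p| < 1 ->
  qpochV p (n%:Z + z) @[n --> \oo] --> (qpoch_inf p p)^-1.
Proof.
move=> p1; have := cvgV (qpoch_inf_neq0 p1 p1) (@qpoch_cvg p p p1).
move=> h A /h [N _ hN]; exists (N + absz z)%N => // n /= Nn.
have -> : n%:Z + z = (absz (n%:Z + z))%:Z by lia.
by apply: hN => /=; lia.
Qed.

Definition theta_bounded (al : int -> C) s := forall t : nat,
  (`|al t%:Z| <= s ^+ t) /\ (`|al (- 1 - t%:Z)| <= s ^+ t).

Lemma zsum_is_cvg al s : 0 <= s < 1 -> theta_bounded al s ->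
  cvg (zsum n al @[n --> \oo]).
Proof.
move=> s01 hal; apply: (@geometric_increments_cvg _ s 2) => // n.
rewrite /zsum big_ord_recr /= addrAC subrr add0r (le_trans (ler_normD _ _)) //.
by have [h1 h2] := hal n; rewrite mulr_natl mulr2n lerD.
Qed.

Lemma bailey_even_cvg p al s (theta : C) : `|p| < 1 -> 0 <= s < 1 ->
  theta_bounded al s -> zsum n al @[n --> \oo] --> theta ->
  bailey (even_ker p) al n @[n --> \oo] --> theta / qpoch_inf p p ^+ 2.
Proof.
move=> p1 s01 hal ht; have /andP[s0 s1] := s01.
have [K K0 hK] := qpochVz_bounded p1.
have kerK n z : `|even_ker p n z| <= K ^+ 2.
  by rewrite normrM expr2 ler_pM.
set P := qpoch_inf p p.
have ker_cvg z : even_ker p n z @[n --> \oo] --> (P ^+ 2)^-1.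
  rewrite expr2 invfM; apply: cvgM; first exact: qpochVz_cvg.
  exact: qpochVz_cvg.
pose D := K ^+ 2 + `|(P ^+ 2)^-1|.
have D1 : K ^+ 2 <= D by rewrite lerDl.
have D2 : `|(P ^+ 2)^-1| <= D by rewrite lerDr exprn_ge0 // ltW.
have D0 : 0 <= D by rewrite (le_trans _ D2).
have bound (x y x' y' : C) m : `|x| <= s ^+ m -> `|x'| <= s ^+ m ->
    `|y| <= D -> `|y'| <= D -> `|x * y + x' * y'| <= 2 * D * s ^+ m.
  move=> hx hx' hy hy'; rewrite (le_trans (ler_normD _ _)) // !normrM.
  rewrite -mulrA mulr_natl mulr2n [D * _]mulrC.
  by rewrite lerD // ler_pM.
apply: (@tannery (fun n m => al m%:Z * even_ker p n m%:Z
    + al (- 1 - m%:Z) * even_ker p n (- 1 - m%:Z))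
  (fun m => (al m%:Z + al (- 1 - m%:Z)) / P ^+ 2) s (2 * D)) => //.
- by rewrite mulr_ge0.
- move=> n m; have [h1 h2] := hal m.
  by apply: bound => //; apply: le_trans D1.
- by move=> m; have [h1 h2] := hal m; rewrite mulrDl; apply: bound.
- move=> m; rewrite mulrDl; apply: cvgD; apply: cvgM => //; exact: cvg_cst.
have -> : (fun n => \sum_(m < n) (al m%:Z + al (- 1 - m%:Z)) / P ^+ 2)
    = (fun n => zsum n al / P ^+ 2).
  by apply/funext => n; rewrite /zsum big_distrl.
by apply: cvgM => //; exact: cvg_cst.
Qed.

(** The same Bailey sums have two limits, one by dominated convergence and one by [finite_jacobi];
    equating them determines [theta]. *)
Lemma jacobi_triple_product (y z s theta : C) : y != 0 -> z != 0 -> `|y| < 1 -> 0 <= s < 1 ->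
  let al (t : int) := (- 1) ^ t * y ^ (t ^+ 2) * z ^ t in
  theta_bounded al s -> zsum n al @[n --> \oo] --> theta ->
  theta = qpoch_inf (y ^+ 2) (y ^+ 2) * qpoch_inf (y * z) (y ^+ 2)
          * qpoch_inf (y / z) (y ^+ 2).
Proof.
move=> y0 z0 y1 s01 al hal ht.
have b1 : `|y ^+ 2| < 1 by rewrite normrX exprn_ilt1.
have hb := norm_lt1_not_root_of_unity b1.
set P := qpoch_inf (y ^+ 2) (y ^+ 2); have P0 : P != 0 by exact: qpoch_inf_neq0.
have h1 := bailey_even_cvg b1 s01 hal ht.
have h2 : bailey (even_ker (y ^+ 2)) al n @[n --> \oo] -->
    qpoch_inf (y * z) (y ^+ 2) * qpoch_inf (y / z) (y ^+ 2) / P.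
  have -> : bailey (even_ker (y ^+ 2)) al = fun n =>
      qpoch (y * z) (y ^+ 2) n * qpoch (y / z) (y ^+ 2) n / qpoch (y ^+ 2) (y ^+ 2) (n + n).
    by apply/funext => n; rewrite -(@finite_jacobi _ _ _ _ _ n.+1).
  apply: cvgM; first by apply: cvgM; exact: qpoch_cvg.
  apply: cvgV => //.
  apply: (@cvg_along (fun n => qpoch (y ^+ 2) (y ^+ 2) n) (fun n => n + n)%N) => [n|].
    by rewrite leq_addr.
  exact: qpoch_cvg.
have := cvg_unique _ h1 h2 => /(_ (@norm_hausdorff _ _)) e.
have -> : theta = theta / P ^+ 2 * P ^+ 2 by rewrite divfK // expf_neq0.
by rewrite e; field.
Qed.

(** * Unordered summation over chains *)

Lemma sum_chain_seqs_le s r n : 0 <= s < 1 ->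
  \sum_(l <- chain_seqs r n) s ^+ sumn l <= (1 - s)^-1 ^+ r.
Proof.
move=> s01; have /andP[s0 s1] := s01.
elim: r n => [|r IHr] n; first by rewrite big_seq1 expr0.
rewrite sum_chain_seqs exprS.
apply: (@le_trans _ _ (\sum_(a < n.+1) s ^+ a * (1 - s)^-1 ^+ r)).
  apply: ler_sum => a _ /=; under eq_bigr do rewrite exprD.
  by rewrite -big_distrr /= ler_wpM2l ?exprn_ge0.
rewrite -big_distrl /= ler_wpM2r ?exprn_ge0 ?invr_ge0 ?subr_ge0 ?(ltW s1) //.
by have := geometric_sum_le 0 n.+1 s01; rewrite big_mkord expr0 div1r.
Qed.

Lemma ler_sum_uniq_sub (T : eqType) (f : T -> C) (L L' : seq T) :
  uniq L -> uniq L' -> {subset L <= L'} -> (forall x, 0 <= f x) ->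
  \sum_(x <- L) f x <= \sum_(x <- L') f x.
Proof.
move=> uL uL' sub f0.
rewrite (perm_big [seq x <- L' | x \in L]) /=; last first.
  apply: uniq_perm => // [|x]; first exact: filter_uniq.
  by rewrite mem_filter; case xL: (x \in L) => //=; rewrite sub.
rewrite big_filter big_mkcond; apply: ler_sum => x _.
by case: ifP.
Qed.

Lemma path_geq_sorted n l : path geq n l = (head 0%N l <= n)%N && sorted geq l.
Proof. by case: l. Qed.

(** The two decaying factors of the bound have separate roles: s^(sumn l) keeps the sum over all
    chains below (1-s)^(-r), and s^(head l) makes the chains with large first part negligible. *)
Lemma partial_sum_chain_cvg r (F : chain r -> C) (G : seq nat -> C) K s (S : C) :
  (forall N, F N = G (val N)) -> 0 <= s < 1 -> 0 <= K ->
  (forall l, size l = r -> `|G l| <= K * s ^+ head 0%N l * s ^+ sumn l) ->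
  \sum_(l <- chain_seqs r n) G l @[n --> \oo] --> S ->
  partial_sum F @ totally --> S.
Proof.
move=> FG s01 K0 hG hS; have /andP[s0 s1] := s01.
have FF : Filter (@totally (chain r)) by exact: (@filter_filter _ _ totally_filter).
apply/cvgrPdist_lt => e e0; have e2 : 0 < e / 2 by rewrite divr_gt0.
have C0 : 0 <= K * (1 - s)^-1 ^+ r.
  by rewrite mulr_ge0 ?exprn_ge0 ?invr_ge0 ?subr_ge0 ?(ltW s1).
move/cvgrPdist_lt: hS => /(_ _ e2) hS.
have [n [hn hSn]] : exists n, K * (1 - s)^-1 ^+ r * s ^+ n < e / 2
    /\ `|S - \sum_(l <- chain_seqs r n) G l| < e / 2.
  have [n _ hn] : \forall n \near \oo, K * (1 - s)^-1 ^+ r * s ^+ n < e / 2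
      /\ `|S - \sum_(l <- chain_seqs r n) G l| < e / 2.
    by near=> n; split; near: n => //; exact: geometric_small.
  by exists n; exact: (hn n (leqnn n)).
pose to_chain (l : seq nat) : option (chain r) :=
  obind (fun t : r.-tuple nat => insub t) (insub l).
have [A0 memA0] : exists A0 : {fset chain r}, A0 =i pmap to_chain (chain_seqs r n).
  by exists (seq_fset tt (pmap to_chain (chain_seqs r n))) => N; exact: seq_fsetE.
exists A0 => // B /= hB.
pose L := [seq tval (val N) | N <- enum_fset B].
have uL : uniq L.
  by rewrite map_inj_uniq ?fset_uniq // => N N' /val_inj /val_inj.
have L_chain l : l \in L -> (size l == r) && sorted geq l.
  by case/mapP => N _ ->; rewrite size_tuple eqxx (valP N).
have L_sup l : l \in chain_seqs r n -> l \in L.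
  rewrite mem_chain_seqs path_geq_sorted => /andP[sl /andP[hl ol]].
  pose N : chain r := exist _ (Tuple sl) ol.
  apply/mapP; exists N => //; apply: (fsubsetP hB).
  rewrite memA0 mem_pmap; apply/mapP; exists l.
    by rewrite mem_chain_seqs path_geq_sorted sl hl.
  by rewrite /to_chain insubT /= insubT; congr Some; apply/val_inj/val_inj.
have -> : partial_sum F B = \sum_(l <- L) G l.
  by rewrite big_map /partial_sum -(big_seq_fsetE _ B xpredT F); apply: eq_bigr.
(* As B contains every chain with first part at most n, its members of that kind are exactly
   [chain_seqs r n]; the others form the error. *)
rewrite (bigID (fun l => head 0%N l <= n)%N) /= -big_filter.
rewrite (perm_big (chain_seqs r n)) /=; last first.
  apply: uniq_perm; [exact: filter_uniq|exact: uniq_chain_seqs|move=> l].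
  rewrite mem_filter; apply/andP/idP => [[hl /L_chain]|hl].
    by rewrite mem_chain_seqs path_geq_sorted hl.
  by split; [move: hl; rewrite mem_chain_seqs path_geq_sorted => /and3P[]|exact: L_sup].
rewrite opprD addrA (le_lt_trans (ler_normB _ _)) // [ltRHS]splitr ltrD //.
apply: le_lt_trans hn; apply: le_trans (ler_norm_sum _ _ _) _.
(* Any bound on the first parts in L serves, since [sum_chain_seqs_le] is uniform in it. *)
pose M := \max_(l <- L) head 0%N l.
apply: (@le_trans _ _ (\sum_(l <- L) K * s ^+ n * s ^+ sumn l)).
  rewrite big_mkcond big_seq [leRHS]big_seq; apply: ler_sum => l /L_chain /andP[/eqP sl _].
  case: ifP => [hl|_]; last by rewrite !mulr_ge0 ?exprn_ge0.
  apply: le_trans (hG l sl) _; rewrite ler_wpM2r ?exprn_ge0 // ler_wpM2l //.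
  by rewrite ler_wiXn2l ?(ltW s1) // ltnW // ltnNge.
rewrite -big_distrr /= [leRHS]mulrAC ler_wpM2l ?mulr_ge0 ?exprn_ge0 //.
apply: le_trans (sum_chain_seqs_le r M s01).
apply: ler_sum_uniq_sub => // [|l lL|l]; rewrite ?uniq_chain_seqs ?exprn_ge0 //.
rewrite mem_chain_seqs path_geq_sorted; have /andP[-> ->] := L_chain l lL.
by rewrite andbT; exact: (@leq_bigmax_seq _ _ xpredT (head 0%N)).
Unshelve. all: by end_near. Qed.

(** * Product identities and the shape of the summand *)

Lemma qpoch_inf_shift q (a : nat) : `|q| < 1 ->
  qpoch (- q) (q ^+ 2) a * qpoch_inf (- q ^+ (1 + 2 * a)) (q ^+ 2)
  = qpoch_inf (- q) (q ^+ 2).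
Proof.
move=> q1; have p1 : `|q ^+ 2| < 1 by rewrite normrX exprn_ilt1.
have h1 : qpoch (- q) (q ^+ 2) (a + n) @[n --> \oo] --> qpoch_inf (- q) (q ^+ 2).
  apply: (@cvg_along (fun n => qpoch (- q) (q ^+ 2) n) (fun n => a + n)%N) => [n|].
    by rewrite leq_addl.
  exact: qpoch_cvg.
apply: (@cvg_unique _ (@norm_hausdorff _ _) _ _ _ _ _ h1).
have -> : (fun n => qpoch (- q) (q ^+ 2) (a + n)) = fun n =>
    qpoch (- q) (q ^+ 2) a * qpoch (- q ^+ (1 + 2 * a)) (q ^+ 2) n.
  by apply/funext => n; rewrite qpochD mulNr -exprM -exprS.
by apply: cvgM; [exact: cvg_cst|exact: qpoch_cvg].
Qed.

(** The odd-exponent factors of (q; q)_(2n) combine with (-q; q^2)_n by (1 - x)(1 + x) = 1 - x^2.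
    This converts (-q; q^2)_oo / (q^2; q^2)_oo into the prefactor of the product side. *)
Lemma qpoch_inf_dissection q : `|q| < 1 ->
  qpoch_inf q q * qpoch_inf (- q) (q ^+ 2)
  = qpoch_inf (q ^+ 2) (q ^+ 4) * qpoch_inf (q ^+ 2) (q ^+ 2).
Proof.
move=> q1; have p1 : `|q ^+ 2| < 1 by rewrite normrX exprn_ilt1.
have p4 : `|q ^+ 4| < 1 by rewrite normrX exprn_ilt1.
have h1 : qpoch q q (n + n) * qpoch (- q) (q ^+ 2) n @[n --> \oo] -->
    qpoch_inf q q * qpoch_inf (- q) (q ^+ 2).
  apply: cvgM; last exact: qpoch_cvg.
  apply: (@cvg_along (fun n => qpoch q q n) (fun n => n + n)%N) => [n|].
    by rewrite leq_addr.
  exact: qpoch_cvg.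
apply: (@cvg_unique _ (@norm_hausdorff _ _) _ _ _ _ h1).
have -> : (fun n => qpoch q q (n + n) * qpoch (- q) (q ^+ 2) n) = fun n =>
    qpoch (q ^+ 2) (q ^+ 4) n * qpoch (q ^+ 2) (q ^+ 2) n.
  apply/funext; elim=> [|n IHn]; first by rewrite !qpoch0.
  rewrite addSn addnS !qpochSr.
  transitivity (qpoch q q (n + n) * qpoch (- q) (q ^+ 2) n
    * ((1 - q ^+ 2 * q ^+ 4 ^+ n) * (1 - q ^+ 2 * q ^+ 2 ^+ n))).
    rewrite -!exprM -!exprS -!exprD mulNr -exprS.
    rewrite (_ : (2 + 4 * n = (2 * n).+1 + (2 * n).+1)%N); last by lia.
    rewrite (_ : (2 + 2 * n = (n + n).+2)%N); last by lia.
    by rewrite (_ : (n + n).+1 = (2 * n).+1) ?exprD; [ring|lia].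
  by rewrite IHn; ring.
by apply: cvgM; exact: qpoch_cvg.
Qed.

(** Extracting q^(-(2l+1)) from each factor reverses the product, and the exponents 1 + 3 + ... +
    (2n-1) add up to n^2. *)
Lemma qpoch_reversal q (n : nat) : q != 0 ->
  q ^+ (n ^ 2) * qpoch (- q ^ (1%:Z - (2 * n)%:Z)) (q ^+ 2) n
  = qpoch (- q) (q ^+ 2) n.
Proof.
move=> q0; elim: n => [|n IHn]; first by rewrite !qpoch0 mulr1.
rewrite qpochS qpochSr -IHn.
have -> : - q ^ (1%:Z - (2 * n.+1)%:Z) * q ^+ 2 = - q ^ (1%:Z - (2 * n)%:Z).
  by rewrite mulNr exprnP -expfzDr //; congr (- (_ ^ _)); lia.
have -> : q ^ (1%:Z - (2 * n.+1)%:Z) = (q ^+ (2 * n).+1)^-1.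
  by rewrite exprnP invr_expz; congr (_ ^ _); lia.
have -> : - q * q ^+ 2 ^+ n = - q ^+ (2 * n).+1 by rewrite mulNr -exprM -exprS.
rewrite (_ : (n.+1 ^ 2 = n ^ 2 + (2 * n).+1)%N); last by lia.
by rewrite exprD; field; rewrite expf_neq0.
Qed.

Lemma chain_weightE p w g n m l : chain_weight p w g n m l
  = (\prod_(t < size l) (qpochV p ((nth 0%N (n :: l) t)%:Z - (nth 0%N l t)%:Z)
      * w (m + t)%N (nth 0%N l t))) * g (last n l).
Proof.
elim: l n m => [|a l IHl] n m; first by rewrite big_ord0 mul1r.
rewrite /= IHl big_ord_recl /= addn0 !mulrA; congr (_ * _ * _).
by apply: eq_bigr => t _; rewrite /= addSnnS.
Qed.

(* The term of the multisum at the chain l, without the factor (-q; q^2)_oo. *)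
Definition first_weight q (i j : nat) (l : seq nat) : C :=
  if l is a :: l' then
    level_weight q i 0 a
      * chain_weight (q ^+ 2) (level_weight q i) (last_weight q j) a 1 l'
  else 0.

Lemma multisum_termE q (j k i : nat) (N : chain k.-1) : `|q| < 1 -> q != 0 ->
  (2 <= k)%N -> (2 <= i)%N ->
  multisum_term q j k i N
  = qpoch_inf (- q) (q ^+ 2) * first_weight q i j (val N).
Proof.
move=> q1 q0; case: k N => [//|[//|k]] [[[//|a l] sl] ol] _ i2.
rewrite /multisum_term /part /= in sl ol *.
move: sl ol => /eqP [sl] ol.
set x := fun m => nth 0%N (a :: l) m.-1.
have hd : \prod_(1 <= m < k.+1) qpoch (q ^+ 2) (q ^+ 2) (x m - x m.+1)
    = (\prod_(t < k) qpochV (q ^+ 2) ((nth 0%N (a :: l) t)%:Z - (nth 0%N l t)%:Z))^-1.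
  rewrite big_add1 big_mkord -prodfV; apply: eq_bigr => t _.
  have := pathP 0%N ol t; rewrite sl => /(_ (ltn_ord t)) /= le.
  by rewrite subzn // /qpochV invrK.
have hl : x k.+1 = last a l by rewrite /x /= -sl (last_nth 0%N).
pose e t : C := q ^+ (2 * x t ^ 2) * (if (i <= t)%N then q ^+ (2 * x t) else 1).
have he : q ^+ (2 * (\sum_(1 <= m < k.+2) x m ^ 2 + \sum_(i <= m < k.+2) x m))
    = \prod_(1 <= t < k.+2) e t.
  rewrite big_split /= mulnDr exprD !big_distrr /= !expr_sum; congr (_ * _).
  rewrite -big_mkcond (@big_nat_widenl _ _ _ i 1) ?(ltnW i2) //=.
have hw : \prod_(t < k) level_weight q i t.+1 (nth 0%N l t)
    = (\prod_(2 <= t < k.+2) e t) * qpoch (- q ^ (1%:Z - (2 * x 2%N)%:Z)) (q ^+ 2) (x 2%N).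
  (* If there is no N_2, [nth] returns 0 for it and the q-product is empty. Otherwise
     [qpoch_reversal] uses up half of q^(2 N_2^2). *)
  clear hd hl he ol; case: k l sl @x @e => [[|//] _|k [//|b l] [sl]] x e.
    by rewrite big_ord0 big_geq // qpoch0 mulr1.
  rewrite big_ord_recl [in RHS]big_ltn // -/(x 2%N) /=.
  rewrite -(qpoch_reversal b q0) [in RHS]mulrAC [e 2%N]/e /x /=.
  congr (_ * _); first by rewrite (mul2n (b ^ 2)) -addnn exprD; ring.
  rewrite !big_add1 big_mkord; apply: eq_bigr => t _.
  by rewrite /e /x /bump.
have q'0 : qpoch (- q) (q ^+ 2) a != 0.
  apply: qpoch_neq0 => m; apply/eqP => h.
  have : `|- q * q ^+ 2 ^+ m| < 1.
    by rewrite -exprM mulNr normrN -exprS normrX exprn_ilt1.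
  by rewrite h normr1 ltxx.
change (q ^+ (2 * (\sum_(1 <= m < k.+2) x m ^ 2 + \sum_(i <= m < k.+2) x m))
  * qpoch (- q ^ (1%:Z - (2 * x 2%N)%:Z)) (q ^+ 2) (x 2%N)
  * qpoch_inf (- q ^+ (1 + 2 * a)) (q ^+ 2)
  / (\prod_(1 <= m < k.+1) qpoch (q ^+ 2) (q ^+ 2) (x m - x m.+1)
     * qpoch (q ^+ (4 - 2 * j)) (q ^+ (4 - 2 * j)) (x k.+1))
  = qpoch_inf (- q) (q ^+ 2) * (q ^+ (2 * a ^ 2) / qpoch (- q) (q ^+ 2) a
     * chain_weight (q ^+ 2) (level_weight q i) (last_weight q j) a 1 l)).
rewrite chain_weightE sl big_split /= hw -(qpoch_inf_shift a q1) hl.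
rewrite -[last_weight q j _]/((qpoch (q ^+ (4 - 2 * j)) (q ^+ (4 - 2 * j)) (last a l))^-1).
rewrite he big_ltn // hd invfM invrK {1}/e leqNgt i2 /= [x 1%N]/x /=.
move: (qpoch (q ^+ (4 - 2 * j)) _ _)^-1 => z.
by field.
Qed.

(** * The limiting theta series *)

Section ThetaTerm.
Variables (q : C) (A B : nat).
Hypotheses (q0 : q != 0) (q1 : `|q| < 1) (BA : (B < A)%N).

Lemma theta_term_jacobi (t : int) : theta_term q A%:Z B%:Z t
  = (- 1) ^ t * (q ^+ A) ^ (t ^+ 2) * (q ^+ B) ^ t.
Proof.
by rewrite /theta_term expfzDr // mulrA !exprnP !exprz_exp.
Qed.

Lemma theta_term_bounded : theta_bounded (theta_term q A%:Z B%:Z) `|q|.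
Proof.
have H z (n : nat) : n%:Z <= A%:Z * z ^+ 2 + B%:Z * z ->
    `|theta_term q A%:Z B%:Z z| <= `|q| ^+ n.
  rewrite /theta_term; case: (_ + _) => // m; rewrite lez_nat => nm.
  rewrite normrM -exprnP normrX.
  have -> : `|(-1 : C) ^ z| = 1.
    by case: z => m'; rewrite ?NegzE -?invr_expz ?normfV -exprnP normrX normrN1 expr1n ?invr1.
  by rewrite mul1r ler_wiXn2l // ltW.
move=> t; split; apply: H; first by nia.
(* As B < A, the second factor is at least 1, so the exponent at -1 - t is at least t. *)
have -> : A%:Z * (-1 - t%:Z) ^+ 2 + B%:Z * (-1 - t%:Z)
    = (t%:Z + 1) * (A%:Z * (t%:Z + 1) - B%:Z) by ring.
nia.
Qed.

Lemma theta_term_product : (0 < A)%N -> zsum n (theta_term q A%:Z B%:Z) @[n --> \oo] -->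
  qpoch_inf (q ^+ (2 * A)) (q ^+ (2 * A)) * qpoch_inf (q ^+ (A - B)) (q ^+ (2 * A))
  * qpoch_inf (q ^+ (A + B)) (q ^+ (2 * A)).
Proof.
move=> A0; have s01 : 0 <= `|q| < 1 by rewrite normr_ge0.
have /cvg_ex [theta ht] := zsum_is_cvg s01 theta_term_bounded.
have y1 : `|q ^+ A| < 1 by rewrite normrX exprn_ilt1 // -lt0n.
have y0 : q ^+ A != 0 by rewrite expf_neq0.
have z0 : q ^+ B != 0 by rewrite expf_neq0.
have e : theta_term q A%:Z B%:Z
    = fun t : int => (- 1) ^ t * (q ^+ A) ^ (t ^+ 2) * (q ^+ B) ^ t.
  by apply/funext => t; rewrite theta_term_jacobi.
have := @jacobi_triple_product _ _ _ theta y0 z0 y1 s01; rewrite -e => /(_ theta_term_bounded ht).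
rewrite -exprM (mulnC A 2) -exprD -expfB // mulrAC => <-.
exact: ht.
Qed.
End ThetaTerm.

(** * Domination of the summand and the limit of the finite identity *)

Lemma level_weightS_bounded q i : `|q| < 1 ->
  exists2 K : C, 0 < K & forall m (a : nat), `|level_weight q i m.+1 a| <= K * `|q| ^+ a.
Proof.
move=> q1; have p1 : `|q ^+ 2| < 1 by rewrite normrX exprn_ilt1.
have [K K0 hK] := qpoch_bounded (- q) p1.
have K1 : 0 < K + 1 by rewrite addr_gt0.
exists (K + 1) => // m a.
have pw n : `|q ^+ n| <= 1 by rewrite normrX exprn_ile1 // ltW.
have sq n : (a <= n)%N -> `|q ^+ n| <= `|q| ^+ a.
  by move=> an; rewrite normrX ler_wiXn2l // ltW.
rewrite [level_weight _ _ _ _]/level_weight normrM.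
apply: (@le_trans _ _ ((K + 1) * `|q| ^+ a * 1)); last by rewrite mulr1.
apply: ler_pM => //; last by case: ifP; rewrite ?normr1.
case: m => [|m].
  rewrite mulrC normrM ler_pM //; last by rewrite sq //; nia.
  by rewrite (le_trans (hK a)) // lerDl.
rewrite -[leLHS]mul1r ler_pM //; first by rewrite lerDr ltW.
by rewrite sq //; nia.
Qed.

(** Since 2 a^2 >= a + a, the first level supplies |q|^a twice: once for the sum of the parts and
    once for the extra decay in the first part. *)
Lemma first_weight_bounded q i j r : `|q| < 1 -> (j <= 1)%N ->
  exists2 K : C, 0 <= K & forall l, size l = r ->
    `|first_weight q i j l| <= K * `|q| ^+ head 0%N l * `|q| ^+ sumn l.
Proof.
move=> q1 j1; have p1 : `|q ^+ 2| < 1 by rewrite normrX exprn_ilt1.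
have [K1 K1_gt0 hK1] := qpochVz_bounded p1.
have [K2 K2_gt0 hK2] := level_weightS_bounded i q1.
have nq1 : `|- q| < 1 by rewrite normrN.
have [K3 K3_gt0 hK3] := qpochV_bounded nq1 p1.
have j4 : `|q ^+ (4 - 2 * j)| < 1 by rewrite normrX exprn_ilt1 //; lia.
have [K4 K4_gt0 hK4] := qpochV_bounded j4 j4.
have K12 : 0 <= K1 * K2 by rewrite mulr_ge0 // ltW.
have hcw l n m : `|chain_weight (q ^+ 2) (level_weight q i) (last_weight q j) n m.+1 l|
    <= (K1 * K2) ^+ size l * K4 * `|q| ^+ sumn l.
  elim: l n m => [|a l IHl] n m; first by rewrite /= mulr1 mul1r hK4.
  rewrite [sumn _]/= [size _]/= exprD.
  rewrite [leRHS](_ : _ = K1 * (K2 * `|q| ^+ a)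
    * ((K1 * K2) ^+ size l * K4 * `|q| ^+ sumn l)); last by rewrite exprS; ring.
  rewrite -[chain_weight _ _ _ _ _ _]/(qpochV _ _ * level_weight q i m.+1 a
    * chain_weight _ _ _ a m.+2 l) !(normrM _ (chain_weight _ _ _ _ _ _)).
  by rewrite ler_pM // normrM ler_pM.
exists (K3 * ((K1 * K2) ^+ r.-1 * K4)).
  by rewrite !mulr_ge0 ?exprn_ge0 // ltW.
case=> [|a l] sl.
  by rewrite normr0 !mulr_ge0 ?exprn_ge0 // ltW.
rewrite /first_weight normrM -sl [head _ _]/= [sumn _]/= [(size _).-1]/=.
rewrite exprD [leRHS](_ : _ = (`|q| ^+ a * `|q| ^+ a * K3)
  * ((K1 * K2) ^+ size l * K4 * `|q| ^+ sumn l)); last by ring.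
rewrite ler_pM // [level_weight _ _ _ _]/level_weight normrM ler_pM //.
by rewrite -exprD normrX ler_wiXn2l ?(ltW q1) //; nia.
Qed.

Lemma multisum_cvg q (j k i : nat) : (j <= 1)%N -> (i <= k)%N -> (2 <= i)%N ->
  (4 < 2 * k + j)%N -> q != 0 -> `|q| < 1 ->
  partial_sum (multisum_term q j k i) @ totally --> product_side q j k i.
Proof.
move=> hj hik hi hkj q0 q1.
have p1 : `|q ^+ 2| < 1 by rewrite normrX exprn_ilt1.
have s01 : 0 <= `|q| < 1 by rewrite normr_ge0.
have hq := norm_lt1_not_root_of_unity q1.
pose A := (2 * k + j - 1)%N; pose B := (2 * k + j - 2 * i)%N.
have BA : (B < A)%N by rewrite /A /B; lia.
set P := qpoch_inf (q ^+ 2) (q ^+ 2); have P0 : P != 0 by exact: qpoch_inf_neq0.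
set E := qpoch_inf (- q) (q ^+ 2).
have htheta := theta_term_product q0 q1 BA (leq_ltn_trans (leq0n B) BA).
set theta := (X in _ --> X) in htheta.
have hbailey := bailey_even_cvg p1 s01 (theta_term_bounded q0 q1 BA) htheta.
rewrite -/P in hbailey.
have [K K0 hK] := first_weight_bounded i k.-1 q1 hj.
(* [b m] gathers the chains with N_1 = m: the finite identity evaluates its sum against 1/(q^2;
   q^2)_(n-m), while the theorem needs the unweighted sum. *)
pose b m := \sum_(l <- chain_seqs k.-2 m) first_weight q i j (m :: l).
have hk : k.-1 = k.-2.+1 by lia.
have hb m : `|b m| <= K * (1 - `|q|)^-1 ^+ k.-2 * `|q| ^+ m.
  rewrite (le_trans (ler_norm_sum _ _ _)) //.
  apply: (@le_trans _ _ (\sum_(l <- chain_seqs k.-2 m) K * `|q| ^+ m * `|q| ^+ sumn l)).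
    rewrite big_seq [leRHS]big_seq; apply: ler_sum => l.
    rewrite mem_chain_seqs => /andP[/eqP sl _].
    have sml : size (m :: l) = k.-1 by rewrite hk /= sl.
    apply: le_trans (hK (m :: l) sml) _.
    rewrite ler_wpM2l ?mulr_ge0 ?exprn_ge0 // ler_wiXn2l ?(ltW q1) //.
    by rewrite /= leq_addl.
  rewrite -big_distrr /= [leRHS]mulrAC ler_wpM2l ?mulr_ge0 ?exprn_ge0 //.
  exact: sum_chain_seqs_le.
have hsum : \sum_(l <- chain_seqs k.-1 n) first_weight q i j l @[n --> \oo] --> theta / P.
  pose D := K * (1 - `|q|)^-1 ^+ k.-2.
  have D0 : 0 <= D by rewrite mulr_ge0 ?exprn_ge0 ?invr_ge0 ?subr_ge0 ?(ltW q1).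
  have [K1 K1_gt0 hK1] := qpochVz_bounded p1.
  have D'0 : 0 <= D * (K1 + `|P^-1|) by rewrite mulr_ge0 // addr_ge0 // ltW.
  have hf n m : `|qpochV (q ^+ 2) (n%:Z - m%:Z) * b m| <= D * (K1 + `|P^-1|) * `|q| ^+ m.
    rewrite normrM mulrC [leRHS]mulrAC ler_pM // (le_trans (hK1 _)) //.
    by rewrite lerDl.
  have hg m : `|P^-1 * b m| <= D * (K1 + `|P^-1|) * `|q| ^+ m.
    by rewrite normrM mulrC [leRHS]mulrAC ler_pM // lerDr ltW.
  (* Domination gives the existence of L, the weighted sums also tend to L by [tannery], and
     comparison with the Bailey sums then identifies L as theta / P^2. *)
  have /cvg_ex [L hL] : cvg (\sum_(m < n) P^-1 * b m @[n --> \oo]).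
    apply: (@geometric_increments_cvg _ `|q| (D * (K1 + `|P^-1|))) => // n.
    by rewrite big_ord_recr /= addrAC subrr add0r.
  have fg m : qpochV (q ^+ 2) (n%:Z - m%:Z) * b m @[n --> \oo] --> P^-1 * b m.
    by apply: cvgM; [exact: qpochVz_cvg|exact: cvg_cst].
  have := tannery s01 D'0 hf hg fg hL.
  have -> : (fun n => \sum_(m < n.+1) qpochV (q ^+ 2) (n%:Z - m%:Z) * b m)
      = bailey (even_ker (q ^+ 2)) (theta_term q A%:Z B%:Z).
    apply/funext => n.
    have -> : A%:Z = (2 * k + j)%:Z - 1 by rewrite /A; lia.
    have -> : B%:Z = (2 * k + j)%:Z - 2 * i%:Z by rewrite /B; lia.
    rewrite -bailey_chain_sum // hk sum_chain_weight; apply: eq_bigr => m _.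
    by rewrite -mulrA; congr (_ * _); rewrite /b big_distrr.
  move=> hL'; have eL := cvg_unique (@norm_hausdorff _ _) hL' hbailey.
  rewrite hk; have -> : (fun n => \sum_(l <- chain_seqs k.-2.+1 n) first_weight q i j l)
      = (fun n => P * \sum_(m < n.+1) P^-1 * b m).
    apply/funext => n; rewrite sum_chain_seqs big_distrr /=; apply: eq_bigr => m _.
    by rewrite mulVKf.
  have -> : theta / P = P * L by rewrite eL; field.
  apply: cvgM; first exact: cvg_cst.
  by rewrite (cvg_shiftS (fun n => \sum_(m < n) P^-1 * b m)).
have -> : product_side q j k i = E * (theta / P).
  have Q0 : qpoch_inf q q != 0 by exact: qpoch_inf_neq0.
  have := qpoch_inf_dissection q1; rewrite -/E -/P /product_side /theta => eE.
  have -> : (4 * k - 2 + 2 * j = 2 * A)%N by rewrite /A; lia.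
  have -> : (2 * i - 1 = A - B)%N by rewrite /A /B; lia.
  have -> : (4 * k - 2 * i - 1 + 2 * j = A + B)%N by rewrite /A /B; lia.
  apply: (mulIf Q0); rewrite divfK //; apply: (mulIf P0).
  rewrite mulrAC -eE; by field.
have ET : multisum_term q j k i = fun N => E * first_weight q i j (val N).
  by apply/funext => N; rewrite multisum_termE //; lia.
have /andP[s0 s1] := s01.
rewrite ET; apply: (@partial_sum_chain_cvg _ _ (fun l => E * first_weight q i j l)
  (`|E| * K) `|q|) => //.
- by rewrite mulr_ge0.
- by move=> l sl; rewrite normrM -!mulrA ler_wpM2l // mulrA hK.
- have -> : (fun n => \sum_(l <- chain_seqs k.-1 n) E * first_weight q i j l)
    = (fun n => E * \sum_(l <- chain_seqs k.-1 n) first_weight q i j l).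
    by apply/funext => n; rewrite big_distrr.
  by apply: cvgM => //; exact: cvg_cst.
Qed.

End Limits.

Theorem theorem1p6 (R : realType) (q : R[i]) (j k i : nat)
    (hj : j \in [:: 0%N; 1%N]) (hik : (i <= k)%N) (hi : (2 <= i)%N)
    (hkj : 2 < (2 * k + j)%:R / 2 :> rat)
    (hq0 : q != 0) (hq : `|q| < 1) :
  partial_sum (multisum_term q j k i) @ totally
    --> product_side q j k i.
Proof.
apply: multisum_cvg => //.
- exact: geometric_small.
- exact: geometric_increments_cvg.
- by move: hj; rewrite !inE => /orP[] /eqP ->.
- by move: hkj; rewrite ltr_pdivlMr // -natrM ltr_nat.
Qed.
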